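(* Let $M_1,M_2\subset\mathbb{R}^n$ be smoothly embedded hypersurfaces. If $$N^*M_1\times N^*M_2\ \text{ is transverse to }\ \{(x_1,\xi,x_2,\xi)\}$$ in $(T^*\mathbb{R}^n\setminus0)^2$, then the center set of $M_1,M_2$ is conic Lagrangian; that is, its lift $$\Big\{\Big(\tfrac{x_1+x_2}{2},\,2\xi\Big) : (x_1,\xi)\in N^*M_1,\ (x_2,\xi)\in N^*M_2\Big\}$$ is a conic Lagrangian submanifold of $T^*\mathbb{R}^n\setminus 0$.
   Context: $T^*\mathbb{R}^n\setminus0$ is the cotangent bundle without zero section, with coordinates $(x,\xi)$, and $N^*M_i$ is the conormal bundle of $M_i$ without zero section. The set $\{(x_1,\xi,x_2,\xi)\}$ is the ''diagonal in the fibre'', i.e. $\{(x_1,\xi_1,x_2,\xi_2)\in(T^*\mathbb{R}^n\setminus0)^2:\xi_1=\xi_2\}$. The center set is the set of midpoints of chords joining a point of $M_1$ and a point of $M_2$ at which the tangent planes are parallel; it is the projection to $\mathbb{R}^n$ of the lift written in the claim. Conic means invariant under multiplication of the fibres by positive scalars. The lift is regarded as a (possibly self-intersecting) immersed manifold, parametrized by $(N^*M_1\times N^*M_2)\cap\{\xi_1=\xi_2\}$. *)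

(* Defs.v *)
From HB Require Import structures.
From mathcomp Require Import all_boot all_order all_algebra.
From mathcomp Require Import all_classical all_reals all_analysis.

Set Implicit Arguments.
Unset Strict Implicit.
Unset Printing Implicit Defensive.

Import Order.TTheory GRing.Theory Num.Theory.
Import numFieldNormedType.Exports.

Local Open Scope classical_set_scope.
Local Open Scope ring_scope.

(* Only finite-dimensional V and W are intended. There, for open A, a map is   *)
(* C^(k+1) on A iff it is differentiable on A and all its directional          *)
(* derivatives are C^k on A.                                                   *)
Fixpoint Ck (R : realType) (V W : normedModType R) (k : nat) (A : set V)
    (f : V -> W) : Prop :=
  match k with
  | 0%N => forall x, A x -> {for x, continuous f}
  | k'.+1 => (forall x, A x -> differentiable f x) /\
             (forall v, Ck k' A ('D_v f))
  end.

Definition smooth (R : realType) (V W : normedModType R) (A : set V)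
    (f : V -> W) : Prop := forall k, Ck k A f.

(* S is an embedded d-dimensional submanifold of V: locally the zero set of a  *)
(* smooth submersion. The dimension d is that of the kernel of the             *)
(* differential, exhibited by a linear isomorphism b from R^d onto it; the     *)
(* codimension is c.                                                           *)
Definition submanifold (R : realType) (V : normedModType R) (d : nat)
    (S : set V) : Prop :=
  forall p, S p -> exists (c : nat) (U : set V) (f : V -> 'rV[R]_c),
    [/\ open U, U p, smooth U f,
        S `&` U = [set x | f x = 0] `&` U
      & forall x, (S `&` U) x ->
          (forall w, exists v, 'd f x v = w) /\
          (exists b : {linear 'rV[R]_d -> V},
             injective b /\ range b = [set v | 'd f x v = 0])].

Definition hypersurface (R : realType) (n : nat) (M : set 'rV[R]_n) : Prop :=
  exists2 d, n = d.+1 & submanifold d M.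

Definition tangent_space (R : realType) (V : normedModType R) (S : set V)
    (p : V) : set V :=
  [set v | exists (e : R) (g : R -> V),
    [/\ 0 < e, smooth `]- e, e[ g, forall t : R, - e < t < e -> S (g t),
        g 0 = p & derive1 g 0 = v]].

Definition transverse (R : realType) (V : normedModType R) (A B : set V) :
    Prop :=
  forall p, A p -> B p -> forall u, exists v w,
    [/\ tangent_space A p v, tangent_space B p w & u = v + w].

(* T^*R^n is R^n * R^n: the covector xi acts on tangent vectors by dot xi.     *)
Notation cotangent R n := ('rV[R]_n * 'rV[R]_n)%type.

Definition dot (R : realType) (n : nat) (xi v : 'rV[R]_n) : R :=
  \sum_(i < n) xi 0 i * v 0 i.

(* The canonical symplectic form d xi /\ d x.                                  *)
Definition omega (R : realType) (n : nat) (u v : cotangent R n) : R :=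
  dot u.2 v.1 - dot v.2 u.1.

Definition zero_section_compl (R : realType) (n : nat) :
    set (cotangent R n) := [set z | z.2 != 0].

Definition conormal (R : realType) (n : nat) (M : set 'rV[R]_n) :
    set (cotangent R n) :=
  [set z | [/\ M z.1, z.2 != 0
             & forall v, tangent_space M z.1 v -> dot z.2 v = 0]].

Definition fibre_diagonal (R : realType) (n : nat) :
    set (cotangent R n * cotangent R n) :=
  (@zero_section_compl R n `*` @zero_section_compl R n) `&`
  [set q | q.1.2 = q.2.2].

Definition conic (R : realType) (n : nat) (L : set (cotangent R n)) : Prop :=
  forall (z : cotangent R n) (t : R), L z -> 0 < t -> L (z.1, t *: z.2).

(* L is the image of the n-dimensional submanifold P of V under F, where F     *)
(* restricts to an immersion of P into T^*R^n \ 0 pulling omega back to 0.     *)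
Definition immersed_lagrangian (R : realType) (n : nat) (V : normedModType R)
    (P : set V) (F : V -> cotangent R n) (L : set (cotangent R n)) : Prop :=
  [/\ submanifold n P,
      exists U : set V, [/\ open U, P `<=` U & smooth U F],
      (forall p v, P p -> tangent_space P p v -> 'd F p v = 0 -> v = 0),
      (forall p v w, P p -> tangent_space P p v -> tangent_space P p w ->
         omega ('d F p v) ('d F p w) = 0)
    & L = F @` P /\ L `<=` @zero_section_compl R n].

Definition center_lift (R : realType) (n : nat) (M1 M2 : set 'rV[R]_n) :
    set (cotangent R n) :=
  [set z | exists x1 x2 xi : 'rV[R]_n,
    [/\ conormal M1 (x1, xi), conormal M2 (x2, xi)
      & z = (2^-1 *: (x1 + x2), 2 *: xi)]].

Definition center_domain (R : realType) (n : nat) (M1 M2 : set 'rV[R]_n) :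
    set (cotangent R n * cotangent R n) :=
  (conormal M1 `*` conormal M2) `&` @fibre_diagonal R n.

Definition center_map (R : realType) (n : nat)
    (q : cotangent R n * cotangent R n) : cotangent R n :=
  (2^-1 *: (q.1.1 + q.2.1), 2 *: q.1.2).

(* Main.v *)
Require Import Defs.
From HB Require Import structures.
From mathcomp Require Import all_boot all_order all_algebra.
From mathcomp Require Import all_classical all_reals all_analysis.
From mathcomp Require Import ring lra.
Import Order.TTheory GRing.Theory Num.Theory.
Import numFieldNormedType.Exports.
Local Open Scope classical_set_scope.
Local Open Scope ring_scope.

Set Implicit Arguments.
Unset Strict Implicit.
Unset Printing Implicit Defensive.

(** The lift is the image of the fibre product P of the two conormal bundles over
    the fibre variable xi, by the linear map that takes the midpoint of the base
    points and doubles xi. Invariance under positive scalars is immediate; the rest has three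
    parts.

    P is a submanifold of dimension n. A hypersurface is locally the zero set of a
    function f with a nonvanishing partial derivative 'D_j f
    (hypersurface_local_equation). Its conormal bundle is then cut out by n
    equations (conormal_eqn, conormalE): f = 0, and the minors expressing that xi
    is proportional to the gradient of f. They form a submersion
    (conormal_eqn_submersion). The two sets of equations together with xi_1 = xi_2
    are 3n equations in dimension 4n, and transversality is precisely what makes
    them independent (center_domain_submanifold).

    Conormal vectors are defined by their pairing with velocities of curves, so that
    the equations hold for them only because each vector in the kernel of the
    differential of f is such a velocity. This is the implicit function theorem for
    one unknown (implicit_curve), obtained from the intermediate value theorem;
    the solution is smooth because its derivative is a smooth function of the
    solution itself.

    The form vanishes on P. Differentiating the equations shows that on tangent
    vectors to a conormal bundle the canonical form is a multiple of the
    antisymmetrization of the Hessian of f, which is zero because second derivatives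
    commute (derive_swap, conormal_isotropic). On vectors with equal fibre parts,
    the pullback of the canonical form by the midpoint map is the sum of the
    canonical forms of the two factors, the scalings by 1/2 and 2 cancelling.

    The map is an immersion on P. A tangent vector in the kernel of its differential
    is ((a, 0), (- a, 0)). By isotropy, a is orthogonal to the fibre parts of all
    vectors tangent to either conormal bundle; by transversality the differences of
    these fibre parts exhaust R^n, so a = 0. *)

(** * Calculus of maps of class C^k *)

Section CkCalculus.
Context {R : realType}.
Implicit Types V W X : normedModType R.

(** The difference of the two maps vanishes near the point, hence is
    negligible there and has differential zero. *)
Lemma near_eq_differentiable V W (f g : V -> W) x :
  (\near x, f x = g x) -> differentiable f x -> differentiable g x.
Proof.
move=> fg df; rewrite -[g](subrK f); apply: differentiableD => //.
have k0 : \forall y \near x, (g - f) y = 0.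
  by apply: filterS fg => y /= e; rewrite !fctE e subrr.
have kx : (g - f) x = 0 by exact: nbhs_singleton k0.
have loc : (g - f) \o shift x = cst ((g - f) x) + (\0 : V -> W) +o_ 0 id.
  apply/eqaddoP => e e0; rewrite kx.
  have : \forall y \near (0 : V), (g - f) (y + x) = 0.
    have : (shift x @ (0 : V)) --> x.
      rewrite -{2}(add0r x); by apply: cvgD; [exact: cvg_id|exact: cvg_cst].
    by move=> /(_ _ k0).
  apply: filterS => y hy; rewrite /= !fctE /=; move: hy; rewrite !fctE => ->.
  by rewrite !addr0 subr0 normr0 mulr_ge0 // ltW.
have c0 : continuous (\0 : V -> W) by exact: cst_continuous.
apply/diff_locallyP; have E := @diff_unique _ _ _ (g - f) \0 x c0 loc.
by rewrite E; split.
Qed.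

Lemma Ck_eq V W k (A : set V) (f g : V -> W) :
  open A -> {in A, f =1 g} -> Ck k A f -> Ck k A g.
Proof.
elim: k f g => [|k IH] f g oA fg /=.
  move=> cf x Ax; have nfg : \near x, f x = g x.
    by near=> y; apply: fg; rewrite inE; near: y; exact: open_nbhs_nbhs.
  change (g @ x --> g x); rewrite -(fg x) ?inE //; apply: cvg_trans (cf x Ax).
  exact: near_eq_cvg.
move=> [df Df]; have nfg x : A x -> \near x, f x = g x.
  by move=> Ax; near=> y; apply: fg; rewrite inE; near: y; exact: open_nbhs_nbhs.
split=> [x Ax|v]; first exact: near_eq_differentiable (nfg x Ax) (df x Ax).
apply: (IH ('D_v f)) => // x; rewrite inE => Ax.
exact: near_eq_derive (nfg x Ax).
Unshelve. all: by end_near. Qed.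

Lemma CkS V W k (A B : set V) (f : V -> W) : A `<=` B -> Ck k B f -> Ck k A f.
Proof.
move=> AB; elim: k f => [|k IH] f /=; first by move=> cf x /AB; exact: cf.
by move=> [df Df]; split=> [x /AB|v]; [exact: df|exact: IH].
Qed.

Lemma CkW V W k (A : set V) (f : V -> W) : Ck k.+1 A f -> Ck k A f.
Proof.
elim: k f => [|k IH] f [df Df].
  by move=> x Ax; apply: differentiable_continuous; exact: df.
by split=> // v; exact: IH.
Qed.

Lemma Ck_cst V W k (A : set V) (c : W) : open A -> Ck k A (cst c : V -> W).
Proof.
move=> oA; elim: k c => [|k IH] c /=; first by move=> x _; exact: cst_continuous.
split=> [x _|v]; first exact: differentiable_cst.
by apply: (@Ck_eq _ _ _ _ (cst 0)) => // x _; rewrite derive_cst.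
Qed.

Lemma Ck_id V k (A : set V) : open A -> Ck k A (id : V -> V).
Proof.
move=> oA; case: k => [|k]; first by move=> x _; exact: cvg_id.
split=> [x _|v]; first by [].
by apply: (@Ck_eq _ _ _ _ (cst v)) => // [x _|]; [rewrite derive_id|exact: Ck_cst].
Qed.

Lemma CkD V W k (A : set V) (f g : V -> W) :
  open A -> Ck k A f -> Ck k A g -> Ck k A (f + g).
Proof.
move=> oA; elim: k f g => [|k IH] f g /=.
  by move=> cf cg x Ax; apply: continuousD; [exact: cf|exact: cg].
move=> [df Df] [dg Dg]; split=> [x Ax|v].
  by apply: differentiableD; [exact: df|exact: dg].
apply: (@Ck_eq _ _ _ _ ('D_v f + 'D_v g)) => //; last exact: IH.
by move=> x; rewrite inE => Ax; rewrite deriveD //; apply: diff_derivable; auto.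
Qed.

Lemma CkM V k (A : set V) (f g : V -> R) :
  open A -> Ck k A f -> Ck k A g -> Ck k A (f * g).
Proof.
move=> oA; elim: k f g => [|k IH] f g cf cg.
  by move=> x Ax; apply: continuousM; [exact: cf|exact: cg].
have [[df Df] [dg Dg]] := (cf, cg); split=> [x Ax|v].
  by apply: differentiableM; [exact: df|exact: dg].
apply: (@Ck_eq _ _ _ _ (f * 'D_v g + g * 'D_v f)) => //.
  by move=> x; rewrite inE => Ax; rewrite deriveM //; apply: diff_derivable; auto.
by apply: CkD => //; apply: IH; first [exact: CkW cf|exact: CkW cg|exact: Df|exact: Dg].
Qed.

Lemma is_derive_Zl V W (c : V -> R) (w : W) x v : differentiable c x ->
  is_derive x v (fun z => c z *: w) ('D_v c x *: w).
Proof.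
move=> dc; have dcw : differentiable (fun z => c z *: w) x.
  exact: differentiableZl.
by apply: DeriveDef; [exact: diff_derivable|rewrite !deriveE // diffZl].
Qed.

Lemma CkZl V W k (A : set V) (c : V -> R) (w : W) :
  open A -> Ck k A c -> Ck k A (fun x => c x *: w).
Proof.
move=> oA; elim: k c => [|k IH] c /=.
  move=> cc x Ax.
  exact: (continuous_comp (cc x Ax) (@scalel_continuous _ _ w (c x))).
move=> [dc Dc]; split=> [x Ax|v]; first by apply: differentiableZl; exact: dc.
apply: (@Ck_eq _ _ _ _ (fun x => 'D_v c x *: w)) => //; last exact: IH.
by move=> x; rewrite inE => Ax; have [_ ->] := is_derive_Zl w v (dc x Ax).
Qed.

Lemma Ck_lincomp V W W' k (A : set V) (L : {linear W -> W'}) (f : V -> W) :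
  open A -> continuous L -> Ck k A f -> Ck k A (L \o f).
Proof.
move=> oA cL; elim: k f => [|k IH] f /=.
  by move=> cf x Ax; apply: continuous_comp; [exact: cf|exact: cL].
move=> [df Df]; split=> [x Ax|v].
  by apply: differentiable_comp; [exact: df|exact: linear_differentiable].
apply: (@Ck_eq _ _ _ _ (L \o 'D_v f)) => //; last exact: IH.
move=> x; rewrite inE => Ax.
have dL : differentiable L (f x) by exact: linear_differentiable.
rewrite deriveE; last by apply: differentiable_comp => //; exact: df.
rewrite diff_comp //; last exact: df.
by rewrite diff_lin //= deriveE //; exact: df.
Qed.

Lemma Ck_complin V V' W k (A : set V) (B : set V') (L : {linear V -> V'})
    (f : V' -> W) :
  open A -> continuous L -> A `<=` L @^-1` B -> Ck k B f -> Ck k A (f \o L).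
Proof.
move=> oA cL AB; elim: k f => [|k IH] f /=.
  by move=> cf x Ax; apply: continuous_comp; [exact: cL|exact: (cf _ (AB _ Ax))].
move=> [df Df]; split=> [x Ax|v].
  by apply: differentiable_comp; [exact: linear_differentiable|exact: (df _ (AB _ Ax))].
apply: (@Ck_eq _ _ _ _ ('D_(L v) f \o L)) => //; last exact: IH.
move=> x; rewrite inE => Ax.
have dL : differentiable L x by exact: linear_differentiable.
have dfx := df _ (AB _ Ax).
rewrite deriveE; last exact: differentiable_comp.
by rewrite diff_comp // diff_lin //= deriveE.
Qed.

(** The derivative is minus the derivative of f times the square of 1/f, so the
    order of smoothness of 1/f climbs by induction. *)
Lemma CkV V k (A : set V) (f : V -> R) : open A ->
  (forall x, A x -> f x != 0) -> Ck k A f -> Ck k A (fun x => (f x)^-1).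
Proof.
move=> oA f0; elim: k => [|k IH] cf.
  by move=> x Ax; apply: continuousV; [exact: f0|exact: cf].
have [df Df] := cf; split=> [x Ax|v].
  by apply: differentiableV; [exact: df|exact: f0].
have cV := IH (CkW cf).
apply: (@Ck_eq _ _ _ _ (cst (-1) * ((fun x => (f x)^-1) * (fun x => (f x)^-1) * 'D_v f))).
- by [].
- move=> x; rewrite inE => Ax; rewrite deriveV;
    [|exact: f0|by apply: diff_derivable; exact: df].
  by rewrite !fctE /= mulN1r -expr2 exprVn /GRing.scale /= mulNr.
- by apply: CkM => //; [exact: Ck_cst|apply: CkM => //; [exact: CkM|exact: Df]].
Qed.

Lemma smooth_derive V W (A : set V) (f : V -> W) v :
  smooth A f -> smooth A ('D_v f).
Proof. by move=> sf k; have [_ +] := sf k.+1; apply. Qed.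

Lemma smooth_differentiable V W (A : set V) (f : V -> W) x :
  smooth A f -> A x -> differentiable f x.
Proof. by move=> sf; have [+ _] := sf 1%N; apply. Qed.

Lemma smooth_continuous V W (A : set V) (f : V -> W) x :
  smooth A f -> A x -> {for x, continuous f}.
Proof. by move=> sf; exact: (sf 0%N). Qed.

Lemma smooth_linear V W (A : set V) (L : {linear V -> W}) :
  open A -> continuous L -> smooth A L.
Proof.
by move=> oA cL k; apply: (@Ck_lincomp _ _ _ k A L id) => //; exact: Ck_id.
Qed.

End CkCalculus.

Section Coordinates.
Context {R : realType}.
Implicit Types V W X : normedModType R.

Lemma derive_coord V n (F : V -> 'rV[R]_n) x v i :
  differentiable F x -> 'D_v (fun y => F y 0 i) x = ('D_v F x) 0 i.
Proof.
by move=> dF; rewrite derive_mx ?mxE //; exact: diff_derivable.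
Qed.

Lemma Ck_coord V n k (A : set V) (F : V -> 'rV[R]_n) i :
  open A -> Ck k A F -> Ck k A (fun x => F x 0 i).
Proof.
move=> oA; elim: k F => [|k IH] F /=.
  move=> cF x Ax.
  exact: (continuous_comp (cF x Ax) (@coord_continuous _ _ _ 0 i (F x))).
move=> [dF DF]; split=> [x Ax|v].
  exact: (differentiable_comp (dF x Ax) (differentiable_coord (F x) 0 i)).
apply: (@Ck_eq _ _ _ _ _ (fun x => ('D_v F x) 0 i)) => //; last exact: IH.
by move=> x; rewrite inE => Ax; rewrite derive_coord //; exact: dF.
Qed.

(** A row-valued map is the sum of its coordinates times the basis vectors, which
    reduces it to scalar functions. *)
Lemma Ck_row V n k (A : set V) (F : V -> 'rV[R]_n) :
  open A -> (forall i, Ck k A (fun x => F x 0 i)) -> Ck k A F.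
Proof.
move=> oA cF.
have -> : F = \sum_(i < n) (fun x => F x 0 i *: 'e_i).
  by apply/funext => x; rewrite fct_sumE; exact: row_sum_delta.
apply: (big_ind (Ck k A)).
- exact: Ck_cst.
- by move=> f g; exact: CkD.
- by move=> i _; exact: CkZl.
Qed.

Lemma derive_row_sum V n (f : 'rV[R]_n -> V) x v : differentiable f x ->
  'D_v f x = \sum_i v 0 i *: 'D_('e_i) f x.
Proof.
move=> df; rewrite deriveE // {1}(row_sum_delta v) linear_sum.
by apply: eq_bigr => i _; rewrite linearZ deriveE.
Qed.

Lemma smooth_row_mx V m1 m2 (A : set V) (F : V -> 'rV[R]_m1) (G : V -> 'rV[R]_m2) :
  open A -> smooth A F -> smooth A G ->
  smooth A (fun x => row_mx (F x) (G x)).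
Proof.
move=> oA sF sG k; apply: Ck_row => // i; case: (split_ordP i) => l ->.
  rewrite (_ : (fun x => _) = fun x => F x 0 l); first exact: Ck_coord.
  by apply/funext => x; rewrite row_mxEl.
rewrite (_ : (fun x => _) = fun x => G x 0 l); first exact: Ck_coord.
by apply/funext => x; rewrite row_mxEr.
Qed.

Lemma diff_row_mx V m1 m2 (F : V -> 'rV[R]_m1) (G : V -> 'rV[R]_m2) x v :
  differentiable (fun x => row_mx (F x) (G x)) x ->
  differentiable F x -> differentiable G x ->
  'd (fun x => row_mx (F x) (G x)) x v = row_mx ('d F x v) ('d G x v).
Proof.
move=> dFG dF dG; rewrite -!deriveE //; apply/rowP => i; rewrite -derive_coord //.
case: (split_ordP i) => l ->.
  rewrite row_mxEl -derive_coord //; congr (derive _ x v).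
  by apply/funext => y; rewrite row_mxEl.
rewrite row_mxEr -derive_coord //; congr (derive _ x v).
by apply/funext => y; rewrite row_mxEr.
Qed.

End Coordinates.

Section Projections.
Context {R : realType}.
Implicit Types V W X : normedModType R.

Lemma fst_cont V W : continuous (@fst V W).
Proof. by move=> x; exact: cvg_fst. Qed.

Lemma snd_cont V W : continuous (@snd V W).
Proof. by move=> x; exact: cvg_snd. Qed.

Lemma open_fst V W (U : set V) : open U -> open (fst @^-1` U : set (V * W)).
Proof. by move=> oU; apply: open_comp => // x _; exact: fst_cont. Qed.

Lemma open_snd V W (U : set W) : open U -> open (snd @^-1` U : set (V * W)).
Proof. by move=> oU; apply: open_comp => // x _; exact: snd_cont. Qed.

Lemma smooth_fst V W X (A : set (V * W)) (B : set V) (f : V -> X) :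
  open A -> A `<=` fst @^-1` B -> smooth B f -> smooth A (fun z => f z.1).
Proof.
move=> oA AB sf k.
exact: (@Ck_complin _ _ _ _ _ _ _ (fst : {linear (V * W)%type -> V}) f oA
  (@fst_cont V W) AB (sf k)).
Qed.

Lemma smooth_snd V W X (A : set (V * W)) (B : set W) (f : W -> X) :
  open A -> A `<=` snd @^-1` B -> smooth B f -> smooth A (fun z => f z.2).
Proof.
move=> oA AB sf k.
exact: (@Ck_complin _ _ _ _ _ _ _ (snd : {linear (V * W)%type -> W}) f oA
  (@snd_cont V W) AB (sf k)).
Qed.

Lemma diff_fst V W X (f : V -> X) (x : V) (y : W) : differentiable f x ->
  differentiable (fun z : V * W => f z.1) (x, y) /\
  (forall w : V * W, 'd (fun z : V * W => f z.1) (x, y) w = 'd f x w.1).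
Proof.
move=> df; pose L : {linear (V * W)%type -> V} := fst.
have dL : differentiable L (x, y).
  by apply: linear_differentiable; exact: fst_cont.
split; first exact: (@differentiable_comp _ _ _ _ L f (x, y) dL df).
move=> w; rewrite -[LHS]/('d (f \o L) (x, y) w) diff_comp //= diff_lin //.
exact: fst_cont.
Qed.

Lemma diff_snd V W X (f : W -> X) (x : V) (y : W) : differentiable f y ->
  differentiable (fun z : V * W => f z.2) (x, y) /\
  (forall w : V * W, 'd (fun z : V * W => f z.2) (x, y) w = 'd f y w.2).
Proof.
move=> df; pose L : {linear (V * W)%type -> W} := snd.
have dL : differentiable L (x, y).
  by apply: linear_differentiable; exact: snd_cont.
split; first exact: (@differentiable_comp _ _ _ _ L f (x, y) dL df).
move=> w; rewrite -[LHS]/('d (f \o L) (x, y) w) diff_comp //= diff_lin //.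
exact: snd_cont.
Qed.

End Projections.

(** * Symmetry of second derivatives *)

Section Schwarz.
Context {R : realType}.
Implicit Types V W X : normedModType R.

Lemma derive_along_line V W (f : V -> W) (p v : V) (s : R) :
  'D_1 (fun s : R => f (p + s *: v)) s = 'D_v f (p + s *: v).
Proof.
rewrite /derive; set g := (X in lim (X @ _) = _); set k := (X in _ = lim (X @ _)).
suff -> : g = k by [].
apply/funext => h; rewrite /g /k /=.
have -> : h *: (1 : R) = h := mulr1 h.
by rewrite scalerDl addrCA.
Qed.

Lemma derivable_along_line V W (f : V -> W) (p v : V) (s : R) :
  derivable f (p + s *: v) v -> derivable (fun s : R => f (p + s *: v)) s 1.
Proof.
rewrite /derivable; set g := (X in cvg (X @ _) -> _).
set h := (X in _ -> cvg (X @ _)).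
suff -> : g = h by [].
apply/funext => t; rewrite /g /h /=.
have -> : t *: (1 : R) = t := mulr1 t.
by rewrite scalerDl addrCA.
Qed.

Lemma growth_rate_translate V W (f : V -> W) (a b v : V) :
  (fun h : R => h^-1 *: (((fun y => f (y + b)) \o shift a) (h *: v)
                          - (fun y => f (y + b)) a))
  = (fun h : R => h^-1 *: ((f \o shift (a + b)) (h *: v) - f (a + b))).
Proof. by apply/funext => h /=; rewrite addrA. Qed.

Lemma derive_translate V W (f : V -> W) (a b v : V) :
  'D_v (fun y => f (y + b)) a = 'D_v f (a + b).
Proof. by rewrite /derive growth_rate_translate. Qed.

Lemma derivable_translate V W (f : V -> W) (a b v : V) :
  derivable (fun y => f (y + b)) a v = derivable f (a + b) v.
Proof. by rewrite /derivable growth_rate_translate. Qed.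

Lemma MVT_along_line V (f : V -> R) (p v : V) (r : R) : 0 < r ->
  (forall s : R, 0 <= s <= r -> derivable f (p + s *: v) v) ->
  exists2 s, 0 < s < r & f (p + r *: v) - f p = r * 'D_v f (p + s *: v).
Proof.
move=> r0 df.
have dl s : 0 <= s <= r -> derivable (fun s : R => f (p + s *: v)) s 1.
  by move=> /df; exact: derivable_along_line.
have [||s] := @MVT R (fun s => f (p + s *: v)) (fun s => 'D_v f (p + s *: v)) 0 r r0.
- move=> s; rewrite in_itv /= => /andP[s0 sr]; apply: DeriveDef.
    by apply: dl; rewrite !ltW.
  exact: derive_along_line.
- by apply: derivable_within_continuous => s; rewrite in_itv; exact: dl.
rewrite in_itv /= => sr; rewrite scale0r addr0 subr0 => ->; exists s => //.
by rewrite mulrC.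
Qed.

(** Two applications of the mean value theorem, first in the direction v to the
    increment of f along r w, then in the direction w to 'D_v f. The left side is
    symmetric in v and w, which is what gives the symmetry of second
    derivatives. *)
Lemma second_difference V (f : V -> R) (x v w : V) (r : R) : 0 < r ->
  (forall s t : R, 0 <= s <= r -> 0 <= t <= r -> differentiable f (x + s *: v + t *: w)
    /\ differentiable ('D_v f) (x + s *: v + t *: w)) ->
  exists s t : R, [/\ 0 < s < r, 0 < t < r &
    f (x + r *: v + r *: w) - f (x + r *: v) - f (x + r *: w) + f x
    = r * r * 'D_w ('D_v f) (x + s *: v + t *: w)].
Proof.
move=> r0 df.
have r_mem : 0 <= r <= r by rewrite ltW //=.
have o_mem : (0 : R) <= 0 <= r by rewrite lexx ltW.
(* The increment of f along r w, as a function of the base point. *)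
pose g y := f (y + r *: w) - f y.
have dv s : 0 <= s <= r -> is_derive (x + s *: v) v g
    ('D_v f (x + s *: v + r *: w) - 'D_v f (x + s *: v)).
  move=> sr.
  have d1 : derivable (fun y => f (y + r *: w)) (x + s *: v) v /\
     'D_v (fun y => f (y + r *: w)) (x + s *: v) = 'D_v f (x + s *: v + r *: w).
    have := @diff_derivable _ _ _ _ _ v (df s r sr r_mem).1.
    by rewrite derive_translate -derivable_translate.
  have d2 : derivable f (x + s *: v) v.
    by have /(@diff_derivable _ _ _ _ _ v) := (df s 0 sr o_mem).1; rewrite scale0r addr0.
  apply: DeriveDef; first exact: derivableB d1.1 d2.
  by rewrite deriveB; [rewrite d1.2|exact: d1.1|exact: d2].
have [s sr|s /andP[s0 sr] Es] := @MVT_along_line V g x v r r0.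
  by have [] := dv _ sr.
have sr' : 0 <= s <= r by rewrite !ltW.
have [t tr|t /andP[t0 tr] Et] := @MVT_along_line V ('D_v f) (x + s *: v) w r r0.
  by apply: diff_derivable; have [] := df s t sr' tr.
exists s, t; split; [by rewrite s0|by rewrite t0|].
rewrite -mulrA -Et; have [_ <-] := dv _ sr'; rewrite -Es /g.
by rewrite opprB addrA [LHS]addrAC.
Qed.

(** For functions that agree only at pairs of nearby points, as those produced by the
    mean value theorem. *)
Lemma eq_at_limit V (F G : V -> R) (x : V) :
  {for x, continuous F} -> {for x, continuous G} ->
  (forall d, 0 < d -> exists y z, [/\ ball x d y, ball x d z & F y = G z]) ->
  F x = G x.
Proof.
move=> cF cG FG; apply/eqP; rewrite -subr_eq0 -normr_le0.
apply/ler_addgt0Pl => e e0; rewrite addr0.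
have e2 : 0 < e / 2 by rewrite divr_gt0.
have /nbhs_ballP[d1 /= d10 B1] := cF _ (nbhsx_ballx (F x) _ e2).
have /nbhs_ballP[d2 /= d20 B2] := cG _ (nbhsx_ballx (G x) _ e2).
have d0 : 0 < Num.min d1 d2 by rewrite lt_min d10.
have [y [z [xy xz FGyz]]] := FG _ d0.
have hF : ball (F x) (e / 2) (F y).
  by apply: B1; apply: le_ball xy; rewrite ge_min lexx.
have hG : ball (G x) (e / 2) (G z).
  by apply: B2; apply: le_ball xz; rewrite ge_min lexx orbT.
move: hF hG; rewrite -!ball_normE /= -FGyz => hF hG.
rewrite -(subrKA (F y)) (le_trans (ler_normD _ _)) // (splitr e).
by rewrite lerD // ltW // distrC.
Qed.

Lemma ball_two_rays V (x v w : V) (d s t : R) : 0 < d ->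
  `|s| <= d / (`|v| + `|w| + 1) -> `|t| <= d / (`|v| + `|w| + 1) ->
  ball x d (x + s *: v + t *: w).
Proof.
set N := _ + 1; move=> d0 hs ht.
have N0 : 0 < N by rewrite ltr_wpDl // addr_ge0.
rewrite -ball_normE /= -addrA opprD addrA subrr sub0r normrN.
apply: le_lt_trans (ler_normD _ _) _; rewrite !normrZ.
apply: (@le_lt_trans _ _ (d / N * (`|v| + `|w|))).
  by rewrite mulrDr lerD // ler_wpM2r.
have {2}-> : d = d / N * N by rewrite divfK // gt_eqF.
by rewrite ltr_pM2l ?divr_gt0 // ltrDl.
Qed.

(** Symmetry of second derivatives: the two iterated derivatives both compute the
    same second difference, at points that may be taken arbitrarily close to x. *)
Theorem derive_swap V (A : set V) (f : V -> R) (x v w : V) :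
  open A -> Ck 2 A f -> A x -> 'D_w ('D_v f) x = 'D_v ('D_w f) x.
Proof.
move=> oA [df Df] Ax; have [[dv Dv] [dw Dw]] := (Df v, Df w).
apply: (@eq_at_limit _ ('D_w ('D_v f)) ('D_v ('D_w f)) x (Dv w x Ax) (Dw v x Ax)).
move=> d1 d10.
have /nbhs_ballP[d2 /= d20 dA] : nbhs x A by exact: open_nbhs_nbhs.
have [d [d0 dB dd1]] : exists d, [/\ 0 < d, forall y, ball x d y -> A y & d <= d1].
  exists (Num.min d1 d2); split; [by rewrite lt_min d10|move=> y xy|].
    by apply: dA; apply: le_ball xy; rewrite ge_min lexx orbT.
  by rewrite ge_min lexx.
pose r := d / (`|v| + `|w| + 1).
have r0 : 0 < r by rewrite divr_gt0 // ltr_wpDl // addr_ge0.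
have box s t : 0 <= s <= r -> 0 <= t <= r -> ball x d (x + s *: v + t *: w).
  move=> /andP[s0 sr] /andP[t0 tr].
  by apply: ball_two_rays; rewrite // ger0_norm.
have [s t sr tr|s1 [t1 [s1r t1r E1]]] := @second_difference V f x v w r r0.
  have Ay := dB _ (box _ _ sr tr).
  by split; [exact: df|exact: dv].
have [s t sr tr|s2 [t2 [s2r t2r E2]]] := @second_difference V f x w v r r0.
  have Ay := dB _ (box _ _ tr sr); rewrite addrAC.
  by split; [exact: df|exact: dw].
have W a : 0 < a < r -> 0 <= a <= r by move=> /andP[a0 ar]; rewrite !ltW.
exists (x + s1 *: v + t1 *: w), (x + t2 *: v + s2 *: w).
split; [apply: le_ball dd1 _ _; exact: box (W _ s1r) (W _ t1r)
  |apply: le_ball dd1 _ _; exact: box (W _ t2r) (W _ s2r)|].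
have rr : r * r != 0 by rewrite mulf_neq0 // gt_eqF.
have cm a b : x + a *: w + b *: v = x + b *: v + a *: w by exact: addrAC.
rewrite !cm in E2; apply: (mulfI rr).
apply: etrans (esym E1) _; apply: etrans _ E2.
by congr (_ + _); exact: addrAC.
Qed.

End Schwarz.

(** * Curves in the zero set of a function *)

Section ImplicitCurve.
Context {R : realType}.
Implicit Types V W X : normedModType R.

Lemma MVT_along_signed_line V (f : V -> R) (p v : V) (r : R) :
  (forall s : R, `|s| <= `|r| -> differentiable f (p + s *: v)) ->
  exists2 s : R, `|s| <= `|r| & f (p + r *: v) - f p = r * 'D_v f (p + s *: v).
Proof.
move=> df; have [r0|r0|->] := ltgtP r 0.
- have nr0 : 0 < - r by rewrite oppr_gt0.
  have [s|s /andP[s0 sr]] := @MVT_along_line R V f p (- v) (- r) nr0 _.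
  + move=> /andP[s0 sr]; apply: diff_derivable; rewrite scalerN -scaleNr.
    by apply: df; rewrite normrN ger0_norm // ltr0_norm.
  + have dfs : differentiable f (p + (- s) *: v).
      by apply: df; rewrite normrN gtr0_norm // ltr0_norm // ltW.
    rewrite scalerN scaleNr opprK scalerN -scaleNr => ->; exists (- s).
      by rewrite normrN gtr0_norm // ltr0_norm // ltW.
    by rewrite !deriveE // linearN mulrNN.
- have [s|s /andP[s0 sr] ->] := @MVT_along_line R V f p v r r0 _.
  + move=> /andP[s1 sr]; apply: diff_derivable.
    by apply: df; rewrite ger0_norm // gtr0_norm.
  + by exists s => //; rewrite gtr0_norm // gtr0_norm // ltW.
- by exists 0; rewrite ?scale0r ?addr0 ?subrr ?mul0r.
Qed.

(** By the chain rule the derivative along the graph of phi involves only phi' and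
    directional derivatives of G, so the smoothness of G is used at every order
    while phi is only as smooth as the composition. *)
Lemma Ck_along_graph V (A : set V) (I : set R) (p v e : V) (phi : R -> R) k
    (G : V -> R) : open I ->
  (forall t, I t -> A (p + t *: v + phi t *: e)) ->
  Ck k I phi -> smooth A G -> Ck k I (fun t => G (p + t *: v + phi t *: e)).
Proof.
move=> oI IA; elim: k G => [|k IH] G cphi sG.
  move=> t It.
  have cx : {for t, continuous (fun t : R => p + t *: v + phi t *: e)}.
    apply: continuousD; first apply: continuousD.
    - exact: cst_continuous.
    - exact: scalel_continuous.
    - exact: (@continuous_comp _ _ _ phi ( *:%R ^~ e) t
        (cphi t It) (@scalel_continuous _ _ e (phi t))).
  exact: (continuous_comp cx (smooth_continuous sG (IA _ It))).
have [dphi Dphi] := cphi.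
pose c (t : R) := p + t *: v + phi t *: e.
have dc t : I t -> differentiable c t /\
    forall s, 'd c t s = s *: v + 'd phi t s *: e.
  move=> It; have dp := differentiableP (dphi t It).
  have H : is_diff t c (fun s => s *: v + 'd phi t s *: e).
    have -> : c = cst p + ( *:%R ^~ v) + (( *:%R ^~ e) \o phi) by [].
    by apply: is_diff_eq; apply/funext => s; rewrite !fctE /= add0r.
  by split=> [|s]; rewrite ?diff_val.
split=> [t It|s].
  exact: (differentiable_comp (dc t It).1 (smooth_differentiable sG (IA _ It))).
apply: (@Ck_eq _ _ _ _ _ (cst s * (fun t => 'D_v G (p + t *: v + phi t *: e))
   + 'D_s phi * (fun t => 'D_e G (p + t *: v + phi t *: e)))) => //.
  move=> t; rewrite inE => It.
  have dG : differentiable G (p + t *: v + phi t *: e).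
    exact: smooth_differentiable (IA _ It).
  have [ct dct] := dc t It.
  rewrite -[RHS]/('D_s (G \o c) t) [RHS]deriveE; last exact: differentiable_comp.
  rewrite (diff_comp ct dG) /= dct linearD !linearZ /=.
  by rewrite !fctE /= !deriveE //; exact: dphi.
have cphi' : Ck k I phi by exact: CkW cphi.
apply: CkD => //; apply: CkM => //.
- exact: Ck_cst.
- exact: (IH _ cphi' (smooth_derive v sG)).
- exact: Dphi.
- exact: (IH _ cphi' (smooth_derive e sG)).
Qed.

(** Between the points of parameters t and h + t, f does not change. Splitting
    the displacement into its v part and its e part and applying the mean value
    theorem to each gives the difference quotient of phi exactly, as minus a
    quotient of 'D_v f by 'D_e f at two points that tend to y. *)
Lemma implicit_is_derive V (f : V -> R) (A : set V) (p v e : V)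
    (phi : R -> R) (t : R) : open A -> smooth A f ->
  (forall x, A x -> 'D_e f x != 0) ->
  A (p + t *: v + phi t *: e) -> {for t, continuous phi} ->
  (\forall s \near t, f (p + s *: v + phi s *: e) = f (p + t *: v + phi t *: e)) ->
  is_derive t 1 phi (- ('D_v f (p + t *: v + phi t *: e) / 'D_e f (p + t *: v + phi t *: e))).
Proof.
move=> oA sf fe Ay cphi f0; set y := p + t *: v + phi t *: e.
suff H : (fun h : R => h^-1 *: ((phi \o shift t) (h *: 1) - phi t)) @ 0^' -->
   (- ('D_v f y / 'D_e f y)).
  apply: DeriveDef; [by apply/cvg_ex; eexists; exact: H|exact: cvg_lim H].
(* The numerator and the denominator will be evaluated at two different points. *)
have cQ : {for (y, y), continuous (fun ab : V * V => - ('D_v f ab.1 / 'D_e f ab.2))}.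
  have cv : {for y, continuous ('D_v f)} by exact: smooth_continuous (smooth_derive v sf) Ay.
  have ce : {for y, continuous ('D_e f)} by exact: smooth_continuous (smooth_derive e sf) Ay.
  have c1 : {for (y, y), continuous ('D_v f \o @fst V V)}.
    by apply: continuous_comp => //; exact: cvg_fst.
  have c2 : {for (y, y), continuous ('D_e f \o @snd V V)}.
    by apply: continuous_comp => //; exact: cvg_snd.
  apply: continuousN; apply: (continuousM c1); apply: (continuousV _ c2).
  exact: fe.
apply/cvgrPdist_lt => eps eps0.
have /nbhs_ballP[d1 /= d10 d1B] : nbhs y A by exact: open_nbhs_nbhs.
have /nbhs_ballP[d2 /= d20 d2B] := cQ _ (nbhsx_ballx _ _ eps0).
pose d := Num.min d1 d2; have d0 : 0 < d by rewrite lt_min d10.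
pose N := `|v| + `|e| + 1; have N0 : 0 < N by rewrite ltr_wpDl // addr_ge0.
have dN0 : 0 < d / N by rewrite divr_gt0.
have small (a b : R) : `|a| < d / N -> `|b| < d / N -> ball y d (y + a *: v + b *: e).
  by move=> ha hb; apply: ball_two_rays => //; exact: ltW.
have cvt : h + t @[h --> 0^'] --> t.
  rewrite -{2}(add0r t); apply: cvgD; last exact: cvg_cst.
  by apply: cvg_within.
have cvp : phi (h + t) @[h --> 0^'] --> phi t by apply: cvg_comp cvt cphi.
have n1 : \forall h \near (0 : R)^', `|phi (h + t) - phi t| < d / N.
  by have /cvgrPdistC_lt /(_ _ dN0) := cvp.
have n2 : \forall h \near (0 : R)^', `|h| < d / N by exact: dnbhs0_lt.
have n3 : \forall h \near (0 : R)^', f (p + (h + t) *: v + phi (h + t) *: e) = f y.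
  exact: (cvt _ f0).
have n4 : \forall h \near (0 : R)^', h != 0 by exact: nbhs_dnbhs_neq.
near=> h.
have hN : `|h| < d / N by near: h.
have pN : `|phi (h + t) - phi t| < d / N by near: h.
have fh : f (p + (h + t) *: v + phi (h + t) *: e) = f y by near: h.
have h0 : h != 0 by near: h.
have ballA x : ball y d x -> A x.
  by move=> yx; apply: d1B; apply: le_ball yx; rewrite ge_min lexx.
have sm0 : `|0 : R| < d / N by rewrite normr0.
(* The displacement is h v followed by (phi (h + t) - phi t) e. *)
have [|s1 s1h E1] := @MVT_along_signed_line V f y v h _.
  move=> s sh; apply: smooth_differentiable sf _; apply: ballA.
  by rewrite -[y + _]addr0 -(scale0r e); apply: small; rewrite ?(le_lt_trans sh).
have [|s2 s2h E2] := @MVT_along_signed_line V f (y + h *: v) e (phi (h + t) - phi t) _.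
  move=> s sh; apply: smooth_differentiable sf _; apply: ballA.
  by apply: small; rewrite ?(le_lt_trans sh).
have Eh : y + h *: v + (phi (h + t) - phi t) *: e = p + (h + t) *: v + phi (h + t) *: e.
  rewrite scalerBl addrA [LHS]addrAC; congr (_ + _).
  by rewrite /y [_ + h *: v]addrAC addrK scalerDl [h *: v + _]addrC addrA.
rewrite Eh fh in E2.
set a := y + s1 *: v in E1; set b := y + h *: v + s2 *: e in E2.
have aB : ball y d a.
  by rewrite /a -[y + _]addr0 -(scale0r e); apply: small; rewrite ?(le_lt_trans s1h).
have bB : ball y d b by apply: small; rewrite ?(le_lt_trans s2h).
have ab : ball (y, y) d2 (a, b).
  by split; [apply: le_ball aB|apply: le_ball bB]; rewrite ge_min lexx orbT.
have := d2B _ ab; rewrite /= -ball_normE /=.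
suff -> : h^-1 *: (phi (h *: 1 + t) - phi t) = - ('D_v f a / 'D_e f b) by [].
have -> : h *: (1 : R) = h := mulr1 h.
have feb : 'D_e f b != 0 by apply: fe; exact: ballA.
have : h * 'D_v f a + (phi (h + t) - phi t) * 'D_e f b = 0.
  by rewrite -E1 -E2 addrC subrKA subrr.
move=> /eqP; rewrite addrC addr_eq0 => /eqP E.
apply: (mulIf feb); apply: (mulfI h0); rewrite mulrA [h * _](mulVKf h0).
by rewrite mulNr mulfVK // mulrN.
Unshelve. all: by end_near. Qed.

Lemma smooth_quotient V (f g : V -> R) (A : set V) :
  open A -> (forall x, A x -> g x != 0) -> smooth A f -> smooth A g ->
  smooth A (fun x => - (f x / g x)).
Proof.
move=> oA g0 sf sg k.
apply: (@Ck_eq _ _ _ _ _ (cst (-1) * (f * (fun x => (g x)^-1)))) => //.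
  by move=> x _; rewrite !fctE /= mulN1r.
by apply: CkM => //; [exact: Ck_cst|apply: CkM => //; exact: CkV].
Qed.

(** The formula for phi' is a smooth function composed with the graph of phi, so phi
    gains one order of smoothness from itself. *)
Lemma implicit_smooth V (f : V -> R) (A : set V) (p v e : V) (phi : R -> R)
    (I : set R) : open A -> smooth A f ->
  (forall x, A x -> 'D_e f x != 0) -> open I ->
  (forall t, I t -> A (p + t *: v + phi t *: e)) ->
  (forall t, I t -> {for t, continuous phi}) ->
  (forall t, I t -> f (p + t *: v + phi t *: e) = 0) ->
  smooth I phi.
Proof.
move=> oA sf fe oI IA cphi f0.
pose q x := - ('D_v f x / 'D_e f x).
have sq : smooth A q.
  by apply: smooth_quotient => //; exact: smooth_derive.
have dphi t : I t -> is_derive t 1 phi (q (p + t *: v + phi t *: e)).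
  move=> It; apply: implicit_is_derive sf fe (IA _ It) (cphi _ It) _ => //.
  have nI : nbhs t I by exact: open_nbhs_nbhs.
  by apply: filterS nI => s Is; rewrite !f0.
elim=> [|k IH]; first exact: cphi.
have dd t : I t -> differentiable phi t.
  by move=> It; apply/derivable1_diffP; have [] := dphi t It.
split=> [//|s].
apply: (@Ck_eq _ _ _ _ _ (cst s * (fun t => q (p + t *: v + phi t *: e)))) => //.
  move=> t; rewrite inE => It; rewrite !fctE /= deriveE; last exact: dd.
  have -> : s = s *: (1 : R) by rewrite [RHS](mulr1 s).
  rewrite linearZ /= -deriveE; last exact: dd.
  by have [_ ->] := dphi t It; rewrite [s *: 1](mulr1 s).
by apply: CkM => //; [exact: Ck_cst|exact: (Ck_along_graph oI IA IH sq)].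
Qed.

(** Along e the function f is strictly increasing near p, so the intermediate
    value theorem solves f (p + t v + s e) = 0 uniquely for s = phi t. *)
Lemma implicit_curve_pos V (f : V -> R) (A : set V) (p v e : V) :
  open A -> smooth A f -> (forall x, A x -> 'D_e f x != 0) -> A p ->
  f p = 0 -> 'D_v f p = 0 -> 0 < 'D_e f p ->
  exists (eps : R) (g : R -> V), [/\ 0 < eps, smooth `]- eps, eps[ g,
    forall t : R, - eps < t < eps -> A (g t) /\ f (g t) = 0, g 0 = p
    & derive1 g 0 = v].
Proof.
move=> oA sf fe Ap fp dvp dep.
have ce : {for p, continuous ('D_e f)} by exact: smooth_continuous (smooth_derive e sf) Ap.
have n1 : nbhs p [set x | 0 < 'D_e f x].
  have /cvgrPdist_lt /(_ _ dep) := ce.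
  apply: filterS => x /=; rewrite ltr_norml => /andP[_].
  by rewrite ltrBlDr ltrDl.
have n2 : nbhs p A by exact: open_nbhs_nbhs.
have [d d0 dB] : exists2 d, 0 < d & forall x, ball p d x -> A x /\ 0 < 'D_e f x.
  have [d1 /= d10 B1] := (nbhs_ballP _ _).1 n1.
  have [d2 /= d20 B2] := (nbhs_ballP _ _).1 n2.
  exists (Num.min d1 d2); first by rewrite lt_min d10.
  move=> x px; split; [apply: B2|apply: B1]; apply: le_ball px.
    by rewrite ge_min lexx orbT.
  by rewrite ge_min lexx.
pose D := d / (`|v| + `|e| + 1).
have D0 : 0 < D by rewrite divr_gt0 // ltr_wpDl // addr_ge0.
have box (t s : R) : `|t| <= D -> `|s| <= D ->
    A (p + t *: v + s *: e) /\ 0 < 'D_e f (p + t *: v + s *: e).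
  by move=> tD sD; apply: dB; exact: ball_two_rays.
pose F (t s : R) := f (p + t *: v + s *: e).
have mono (t s1 s2 : R) : `|t| <= D -> `|s1| <= D -> `|s2| <= D -> s1 < s2 -> F t s1 < F t s2.
  move=> tD s1D s2D s12.
  have r0 : 0 < s2 - s1 by rewrite subr_gt0.
  have sub u : 0 <= u <= s2 - s1 -> `|s1 + u| <= D.
    move: s1D s2D; rewrite !ler_norml => /andP[a1 a2] /andP[b1 b2] /andP[u0 u1].
    by apply/andP; split; lra.
  have [|u /andP[u0 u1]] := @MVT_along_line R V f (p + t *: v + s1 *: e) e (s2 - s1) r0.
    move=> u /sub uD; apply: diff_derivable.
    rewrite -addrA -scalerDl.
    by apply: smooth_differentiable sf _; exact: (box _ _ tD uD).1.
  rewrite -!addrA -!scalerDl subrKC !addrA -/(F t s1) -/(F t s2) => E.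
  rewrite -subr_gt0 E mulr_gt0 //.
  by apply: (box _ _ tD _).2; apply: sub; rewrite !ltW.
have inj (t s1 s2 : R) : `|t| <= D -> `|s1| <= D -> `|s2| <= D -> F t s1 = F t s2 -> s1 = s2.
  move=> tD s1D s2D E; case: (ltgtP s1 s2) => // h.
    by have := mono _ _ _ tD s1D s2D h; rewrite E ltxx.
  by have := mono _ _ _ tD s2D s1D h; rewrite E ltxx.
have cFt (t s : R) : `|t| <= D -> `|s| <= D -> {for t, continuous (F ^~ s)}.
  move=> tD sD.
  have cx : {for t, continuous (fun t : R => p + t *: v + s *: e)}.
    apply: continuousD; first apply: continuousD.
    - exact: cst_continuous.
    - exact: scalel_continuous.
    - exact: cst_continuous.
  exact: (continuous_comp cx (smooth_continuous sf (box _ _ tD sD).1)).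
have cFs (t s : R) : `|t| <= D -> `|s| <= D -> {for s, continuous (F t)}.
  move=> tD sD.
  have cx : {for s, continuous (fun s : R => p + t *: v + s *: e)}.
    apply: continuousD; first exact: cst_continuous.
    exact: scalel_continuous.
  exact: (continuous_comp cx (smooth_continuous sf (box _ _ tD sD).1)).
(* Local solvability near any zero, within a prescribed distance eta. At the
   origin it produces phi; at the other points, with inj, it makes phi
   continuous. *)
have solve (t0 s0 eta : R) : `|t0| < D -> `|s0| <= D / 2 -> F t0 s0 = 0 -> 0 < eta ->
    eta <= D / 2 ->
    \forall t \near t0, exists s : R, [/\ `|s - s0| <= eta, `|s| <= D & F t s = 0].
  move=> t0D s0D F0 eta0 etaD.
  have dom s : s0 - eta <= s <= s0 + eta -> `|s| <= D.
    move: s0D; rewrite !ler_norml => /andP[a1 a2] /andP[b1 b2].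
    by apply/andP; split; lra.
  have m1 : `|s0 - eta| <= D by apply: dom; apply/andP; split; lra.
  have m2 : `|s0 + eta| <= D by apply: dom; apply/andP; split; lra.
  have m0 : `|s0| <= D by apply: dom; apply/andP; split; lra.
  have t0D' := ltW t0D.
  have F1 : F t0 (s0 - eta) < 0.
    by rewrite -F0; apply: mono => //; rewrite ltrBlDr ltrDl.
  have F2 : 0 < F t0 (s0 + eta) by rewrite -F0; apply: mono => //; rewrite ltrDl.
  have k1 : \forall t \near t0, F t (s0 - eta) < 0.
    exact: (cvgr_lt _ (cFt _ _ t0D' m1)).
  have k2 : \forall t \near t0, 0 < F t (s0 + eta).
    exact: (cvgr_gt _ (cFt _ _ t0D' m2)).
  have k3 : \forall t \near t0, `|t| < D.
    exact: (@cvgr_norm_lt R R R (nbhs t0) _ idfun t0 cvg_id _ t0D).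
  near=> t.
  have tD : `|t| <= D by apply: ltW; near: t.
  have G1 : F t (s0 - eta) < 0 by near: t.
  have G2 : 0 < F t (s0 + eta) by near: t.
  have le12 : s0 - eta <= s0 + eta by lra.
  have [||s] := @IVT R (F t) _ _ 0 le12.
  - apply: continuous_in_subspaceT => s; rewrite inE /= in_itv /= => sI.
    exact: cFs (dom _ sI).
  - rewrite min_l ?max_r ?(ltW G1) ?(ltW G2) //; apply: ltW; exact: lt_trans G2.
  rewrite in_itv /= => sI Fs; exists s; split=> //; last exact: dom.
  by rewrite ler_distl.
(* Solutions are confined to half of the box, which leaves the room that solve
   asks for around each of them. *)
have [eps [eps0 epsD Heps]] : exists eps : R, [/\ 0 < eps, eps <= D &
    forall t : R, `|t| < eps -> exists s : R, `|s| <= D / 2 /\ F t s = 0].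
  have D20 : 0 < D / 2 by rewrite divr_gt0.
  have := solve 0 0 (D / 2); rewrite !normr0 {1}/F !scale0r !addr0 fp.
  move=> /(_ D0 (ltW D20) erefl D20 (lexx _)) /nbhs_ballP[d1 /= d10 B1].
  exists (Num.min d1 D); split; first by rewrite lt_min d10.
    by rewrite ge_min lexx orbT.
  move=> t; rewrite lt_min => /andP[t1 t2].
  have /B1 [s [sD _ Fs]] : ball (0 : R) d1 t by rewrite -ball_normE /= sub0r normrN.
  by rewrite subr0 in sD; exists s.
have /choice[phi Hphi] : forall t : R, exists s : R, `|t| < eps -> `|s| <= D / 2 /\ F t s = 0.
  move=> t; have [tE|tE] := boolP (`|t| < eps); last by exists 0.
  by have [s Hs] := Heps t tE; exists s.
have D2D : D / 2 <= D by lra.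
have pD (t : R) : `|t| < eps -> `|phi t| <= D by move=> /Hphi[+ _] => /le_trans; apply.
have tD (t : R) : `|t| < eps -> `|t| <= D by move=> /ltW /le_trans; apply.
pose I : set R := [set` `]- eps, eps[ ].
have oI : open I by exact: interval_open.
have IE t : I t <-> `|t| < eps by rewrite /I /= in_itv /= ltr_norml.
have cphi t : I t -> {for t, continuous phi}.
  move=> /IE tE; apply/cvgrPdist_le => eta eta0.
  have [pt Ft] := Hphi t tE.
  have e1 : 0 < Num.min eta (D / 2) by rewrite lt_min eta0 divr_gt0.
  have e2 : Num.min eta (D / 2) <= D / 2 by rewrite ge_min lexx orbT.
  have H := solve t (phi t) _ (lt_le_trans tE epsD) pt Ft e1 e2.
  have H2 : \forall u \near t, `|u| < eps.
    exact: (@cvgr_norm_lt R R R (nbhs t) _ idfun t cvg_id _ tE).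
  apply: filterS2 H H2 => u [s [s1 s2 s3]] uE.
  have -> : phi u = s.
    by apply: (inj u) => //; [exact: tD|exact: pD|rewrite s3; exact: (Hphi u uE).2].
  by rewrite distrC (le_trans s1) // ge_min lexx.
have IA t : I t -> A (p + t *: v + phi t *: e).
  by move=> /IE tE; have [] := box _ _ (tD _ tE) (pD _ tE).
have f0 t : I t -> f (p + t *: v + phi t *: e) = 0.
  by move=> /IE tE; exact: (Hphi t tE).2.
have sphi : smooth I phi by exact: (implicit_smooth oA sf fe oI IA cphi f0).
have I0 : I 0 by apply/IE; rewrite normr0.
have phi0 : phi 0 = 0.
  have E0 : `|0 : R| < eps by rewrite normr0.
  apply: (inj 0); [exact: tD|exact: pD| |]; first by rewrite normr0 ltW.
  by rewrite (Hphi 0 E0).2 /F !scale0r !addr0 fp.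
pose g (t : R) := p + t *: v + phi t *: e.
exists eps, g; split=> //.
- move=> k; apply: CkD => //; first apply: CkD => //.
  + exact: Ck_cst.
  + by apply: CkZl => //; exact: Ck_id.
  + exact: CkZl.
- by move=> t tE; have It : I t; [rewrite /I /= in_itv|split; [exact: IA|exact: f0]].
- by rewrite /g phi0 !scale0r !addr0.
- have dphi : is_derive (0 : R) 1 phi 0.
    rewrite -[X in is_derive _ _ _ X](_ : - ('D_v f (p + (0 : R) *: v + phi 0 *: e)
        / 'D_e f (p + (0 : R) *: v + phi 0 *: e)) = _); last first.
      by rewrite phi0 !scale0r !addr0 dvp mul0r oppr0.
    apply: (implicit_is_derive oA sf fe (IA _ I0) (cphi _ I0)).
    have nI : nbhs 0 I by exact: open_nbhs_nbhs.
    by apply: filterS nI => s Is; rewrite !f0.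
  have dphi0 : differentiable phi 0 by apply/derivable1_diffP; case: dphi.
  have did : differentiable (fun t : R => t) (0 : R) by [].
  have d1 := @is_derive_Zl R R V (fun t : R => t) v 0 1 did.
  have d2 := @is_derive_Zl R R V phi e 0 1 dphi0.
  rewrite derive1E (_ : g = cst p + (fun t : R => t *: v) + (fun t => phi t *: e)) //.
  have [_ ->] := is_deriveD (is_deriveD (is_derive_cst p (0 : R) 1) d1) d2.
  by have [_ ->] := dphi; rewrite derive_id scale0r addr0 add0r scale1r.
Unshelve. all: by end_near. Qed.

(** Implicit function theorem in the form needed here: every vector killed by the
    differential of f is the velocity of a smooth curve in the zero set. Only one
    unknown is solved for, which is why the intermediate value theorem suffices. *)
Theorem implicit_curve V (f : V -> R) (A : set V) (p v e : V) :
  open A -> smooth A f -> (forall x, A x -> 'D_e f x != 0) -> A p ->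
  f p = 0 -> 'D_v f p = 0 ->
  exists (eps : R) (g : R -> V), [/\ 0 < eps, smooth `]- eps, eps[ g,
    forall t : R, - eps < t < eps -> A (g t) /\ f (g t) = 0, g 0 = p
    & derive1 g 0 = v].
Proof.
move=> oA sf fe Ap fp dvp.
have Ne x : A x -> 'D_(- e) f x = - 'D_e f x.
  by move=> Ax; have dfx := smooth_differentiable sf Ax; rewrite !deriveE // linearN.
have [lt0|gt0|/eqP] := ltgtP ('D_e f p) 0; last by rewrite (negPf (fe p Ap)).
  apply: (@implicit_curve_pos V f A p v (- e)) => //.
    by move=> x Ax; rewrite Ne // oppr_eq0; exact: fe.
  by rewrite Ne // oppr_gt0.
exact: (@implicit_curve_pos V f A p v e).
Qed.

Lemma tangent_spaceS V (S T : set V) p :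
  S `<=` T -> tangent_space S p `<=` tangent_space T p.
Proof.
move=> ST v [e [g [e0 sg Sg g0 g1]]]; exists e, g; split=> // t /Sg; exact: ST.
Qed.

(** The easy half of the comparison of tangent vectors with kernels: f is constant
    along the curve, whose velocity is therefore killed by the differential. *)
Lemma tangent_diff0 V W (S : set V) (h : V -> W) (p v : V) :
  tangent_space S p v -> differentiable h p ->
  (\forall x \near p, S x -> h x = 0) -> 'd h p v = 0.
Proof.
move=> [e [g [e0 sg Sg gp gv]]] dh nh.
have I0 : `]- e, e[%classic (0 : R) by rewrite /= in_itv /= e0 oppr_lt0 e0.
have dg : differentiable g 0 by exact: smooth_differentiable sg I0.
rewrite -gv derive1E' // -gp -[LHS]/(('d h (g 0) \o 'd g 0) 1).
rewrite -gp in dh nh.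
rewrite -diff_comp // -deriveE; last exact: differentiable_comp.
suff E : 'D_1 (h \o g) 0 = 'D_1 (cst 0 : R -> W) 0 by rewrite E derive_cst.
apply: near_eq_derive.
have n1 : \forall t \near (0 : R), S (g t) -> h (g t) = 0.
  exact: (differentiable_continuous dg nh).
have n2 : nbhs (0 : R) `]- e, e[%classic.
  by apply: open_nbhs_nbhs; split=> //; exact: interval_open.
near=> t; have tI : `]- e, e[%classic t by near: t.
apply: (near n1 t) => //; apply: Sg; by move: tI; rewrite /= in_itv.
Unshelve. all: by end_near. Qed.

End ImplicitCurve.

(** * Kernels of surjective linear maps *)

Section LinearAlgebra.
Context {R : fieldType}.

Lemma kernel_basis (V : vectType R) m d (L : {linear V -> 'rV[R]_m}) :
  dim V = (d + m)%N -> (forall w, exists v, L v = w) ->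
  exists b : {linear 'rV[R]_d -> V},
    injective b /\ range b = [set v | L v = 0].
Proof.
move=> dV surjL; pose K := lker (linfun L).
have dK : \dim K = d.
  have := limg_ker_dim (linfun L) fullv; rewrite capfv dimvf dV.
  suff -> : (linfun L @: fullv = fullv)%VS.
    by rewrite dimvf dim_matrix mul1r; exact: addIn.
  apply/vspaceP => w; rewrite memvf; have [v <-] := surjL w.
  by rewrite -lfunE memv_img // memvf.
move: (vbasisP K); move: (vbasis K); rewrite dK => X bX.
pose b (u : 'rV[R]_d) : V := \sum_(i < d) u 0 i *: X`_i.
have bl : linear b.
  move=> a u v; rewrite /b scaler_sumr -big_split /=; apply: eq_bigr => i _.
  by rewrite !mxE scalerDl scalerA.
pose bM := GRing.isLinear.Build _ _ _ _ _ bl.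
pose bL : {linear 'rV[R]_d -> V} := HB.pack b bM.
exists bL; split.
  move=> u v /= uv; apply/rowP => i.
  have fX := basis_free bX.
  by rewrite -(coord_sum_free (fun i => u 0 i) i fX) -/(b u) uv coord_sum_free.
apply/seteqP; split=> v /=.
  move=> [u _ <-]; apply/eqP; rewrite -lfunE -memv_ker.
  by apply: memv_suml => i _; apply/memvZ/(basis_mem bX)/mem_nth; rewrite size_tuple.
move=> Lv; have vK : v \in K by rewrite memv_ker lfunE Lv.
exists (\row_i coord X i v) => //; rewrite [RHS](coord_basis bX vK).
by apply: eq_bigr => i _; rewrite mxE.
Qed.

Lemma kernel_dim (V : vectType R) m d (L : {linear V -> 'rV[R]_m})
    (b : {linear 'rV[R]_d -> V}) :
  (forall w, exists v, L v = w) -> injective b ->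
  range b = [set v | L v = 0] -> dim V = (d + m)%N.
Proof.
move=> surjL injb kb; rewrite -dimvf -(limg_ker_dim (linfun L) fullv) capfv.
have -> : (linfun L @: fullv = fullv)%VS.
  apply/vspaceP => w; rewrite memvf; have [v <-] := surjL w.
  by rewrite -lfunE memv_img // memvf.
rewrite dimvf dim_matrix mul1r; congr (_ + _)%N.
have -> : lker (linfun L) = (linfun b @: fullv)%VS.
  apply/vspaceP => v; rewrite memv_ker lfunE /=.
  have [E1 E2] : (L v = 0 -> exists u, b u = v) /\ ((exists u, b u = v) -> L v = 0).
    have := congr1 (fun S => S v) kb; rewrite /= => kbv.
    by split=> [|[u uv]]; rewrite -kbv; [case=> u _ <-; exists u|exists u].
  apply/eqP/memv_imgP => [/E1[u <-]|[u _ vu]].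
    by exists u; rewrite ?memvf ?lfunE.
  by apply: E2; exists u; rewrite vu lfunE.
rewrite limg_dim_eq; first by rewrite dimvf dim_matrix mul1r.
rewrite capfv; apply/eqP/lker0P => u v.
by rewrite !lfunE => /injb.
Qed.

End LinearAlgebra.

(** * The pairing of covectors and vectors *)

Section Dot.
Context {R : realType} {n : nat}.

Lemma dotC (xi v : 'rV[R]_n) : dot xi v = dot v xi.
Proof. by apply: eq_bigr => i _; rewrite mulrC. Qed.

Lemma dotDr (xi v w : 'rV[R]_n) : dot xi (v + w) = dot xi v + dot xi w.
Proof. by rewrite /dot -big_split; apply: eq_bigr => i _; rewrite mxE mulrDr. Qed.

Lemma dotZr (xi v : 'rV[R]_n) a : dot xi (a *: v) = a * dot xi v.
Proof. by rewrite /dot mulr_sumr; apply: eq_bigr => i _; rewrite mxE mulrCA. Qed.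

Lemma dotNr (a b : 'rV[R]_n) : dot a (- b) = - dot a b.
Proof. by rewrite -scaleN1r dotZr mulN1r. Qed.

Lemma dotBl (a b c : 'rV[R]_n) : dot (a - b) c = dot a c - dot b c.
Proof. by rewrite dotC dotDr dotNr !(dotC c). Qed.

Lemma dot0l (a : 'rV[R]_n) : dot 0 a = 0.
Proof. by rewrite -(subrr a) dotBl subrr. Qed.

(** The scalings of the center map by 1/2 on the base and 2 in the fibre cancel in
    the symplectic form. *)
Lemma dot_double_half (a b : 'rV[R]_n) :
  dot (2 *: a) (2^-1 *: b) = dot a b.
Proof. by rewrite dotZr dotC dotZr dotC mulrA mulVf ?mul1r ?pnatr_eq0. Qed.

Lemma dot_delta (xi : 'rV[R]_n) i : dot xi 'e_i = xi 0 i.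
Proof.
rewrite /dot (bigD1 i) //= big1 ?addr0 => [|k ki].
  by rewrite mxE !eqxx mulr1.
by rewrite mxE eqxx (negPf ki) mulr0.
Qed.

Lemma dot_eq0 (a : 'rV[R]_n) : (forall c, dot c a = 0) -> a = 0.
Proof. by move=> a0; apply/rowP => i; rewrite mxE -(dot_delta a) dotC a0. Qed.

End Dot.

(** * Hypersurfaces and their conormal bundles *)

Section LocalEquation.
Context {R : realType} {n : nat}.
Implicit Types (M U : set 'rV[R]_n) (f : 'rV[R]_n -> R) (j : 'I_n).

Lemma open_neq0 (V : normedModType R) (U : set V) (g : V -> R) :
  open U -> (forall x, U x -> {for x, continuous g}) ->
  open (U `&` [set x | g x != 0]).
Proof.
move=> oU cg; rewrite openE => x [Ux gx]; apply: filterI.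
  exact: open_nbhs_nbhs.
have gx0 : 0 < `|g x| by rewrite normr_gt0.
have /cvgrPdist_lt /(_ _ gx0) := cg x Ux.
apply: filterS => y /=; apply: contraTneq => ->.
by rewrite subr0 ltxx.
Qed.

(** Stated with products of R, so that the sum combines with those of dot. *)
Lemma directional_gradient f x v : differentiable f x ->
  'D_v f x = \sum_i v 0 i * 'D_('e_i) f x.
Proof. exact: derive_row_sum. Qed.

(** The scalar form of a hypersurface near a point: a function whose
    derivative along a fixed coordinate j does not vanish on U. Fixing j makes the
    equations of the conormal bundle below polynomial in the derivatives of f. *)
Definition local_equation M U f j : Prop :=
  [/\ open U, smooth U f, forall x, U x -> M x <-> f x = 0
    & forall x, U x -> 'D_('e_j) f x != 0].

(** Counting dimensions, the submersion that cuts out a hypersurface has a single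
    component. Its differential is nonzero at p, so some partial derivative is. *)
Lemma hypersurface_local_equation M p : hypersurface M -> M p ->
  exists U f j, local_equation M U f j /\ U p.
Proof.
move=> [d nd subM] Mp; have [c [U [F [oU Up sF MU dF]]]] := subM p Mp.
have [surjF [b [injb kb]]] := dF p (conj Mp Up).
have c1 : c = 1%N.
  have := kernel_dim surjF injb kb; rewrite dim_matrix mul1r nd => /eqP.
  by rewrite -addn1 eqn_add2l => /eqP.
subst c; pose f x := F x 0 0.
have sf : smooth U f by move=> k; exact: Ck_coord.
have dFp : differentiable F p := smooth_differentiable sF Up.
have dfp : differentiable f p := smooth_differentiable sf Up.
have [v dFv] := surjF (const_mx 1).
have dfv : 'D_v f p = 1 by rewrite derive_coord // deriveE // dFv mxE.
have [j dj] : exists j, 'D_('e_j) f p != 0.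
  apply/existsP; rewrite -negb_forall; apply/negP => /forallP all0.
  move: dfv; rewrite derive_row_sum // big1 => [/eqP|i _].
    by rewrite eq_sym oner_eq0.
  by rewrite (eqP (all0 i)) scaler0.
exists (U `&` [set x | 'D_('e_j) f x != 0]), f, j; split; last by [].
split=> [|k|x [Ux _]|x []//].
- by apply: open_neq0 => // x; exact: smooth_continuous (smooth_derive _ sf).
- by apply: CkS (sf k) => x [].
- have E : (M `&` U) x = ([set x | F x = 0] `&` U) x by rewrite MU.
  split=> [Mx|fx].
    have [Fx _] : ([set x | F x = 0] `&` U) x by rewrite -E.
    by rewrite /f [F x]Fx mxE.
  suff [] : (M `&` U) x by [].
  rewrite E; split=> //=; apply/rowP => i; rewrite ord1 mxE; exact: fx.
Qed.

(** These n equations say that f vanishes (component j) and that xi is proportional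
    to the gradient of f (the other components, which are 2 x 2 minors; the minor of
    index j is identically zero and leaves its place to f). *)
Definition conormal_eqn f j (z : cotangent R n) : 'rV[R]_n :=
  \row_k ('D_('e_j) f z.1 * z.2 0 k - z.2 0 j * 'D_('e_k) f z.1
          + (k == j)%:R * f z.1).

Lemma conormal_eqn_eq0 f j z : conormal_eqn f j z = 0 <->
  f z.1 = 0 /\ forall k, 'D_('e_j) f z.1 * z.2 0 k = z.2 0 j * 'D_('e_k) f z.1.
Proof.
split=> [h0|[fz hz]].
  have E k := congr1 (fun u : 'rV[R]_n => u 0 k) h0.
  have fz : f z.1 = 0.
    by have := E j; rewrite !mxE eqxx mul1r mulrC subrr add0r.
  split=> // k; have := E k; rewrite !mxE fz mulr0 addr0 => /eqP.
  by rewrite subr_eq0 => /eqP.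
by apply/rowP => k; rewrite !mxE hz fz subrr mulr0 addr0.
Qed.

Lemma tangent_space_kernel M U f j x v : local_equation M U f j -> U x ->
  f x = 0 -> 'D_v f x = 0 -> tangent_space M x v.
Proof.
move=> [oU sf MU fj] Ux fx dv.
have [e [g [e0 sg Ug g0 g1]]] := implicit_curve oU sf fj Ux fx dv.
by exists e, g; split=> // t /Ug[Ut ft]; apply/MU.
Qed.

(** That conormal vectors satisfy the equations needs tangent vectors to test
    against: the minor of index k is the pairing of xi with ('D_j f) e_k - ('D_k f)
    e_j, which lies in the kernel of the differential of f, hence is tangent by the
    implicit function theorem. *)
Lemma conormalE M U f j (z : cotangent R n) : local_equation M U f j -> U z.1 ->
  conormal M z <-> z.2 != 0 /\ conormal_eqn f j z = 0.
Proof.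
case: z => x xi /= leq Uz; have [oU sf MU fj] := leq; have dfz := smooth_differentiable sf Uz.
split=> [[/= Mz z0 tz]|[z0 /conormal_eqn_eq0[/= fz hz]]].
  have fz : f x = 0 by apply/MU.
  split=> //; apply/conormal_eqn_eq0; split=> // k.
  pose v : 'rV[R]_n := 'D_('e_j) f x *: 'e_k + (- 'D_('e_k) f x) *: 'e_j.
  have /tz : tangent_space M x v.
    apply: (tangent_space_kernel leq) => //.
    by rewrite deriveE // linearD !linearZ /= -!deriveE // scaleNr /GRing.scale /= mulrC subrr.
  rewrite dotDr !dotZr !dot_delta mulNr => /eqP; rewrite subr_eq0 => /eqP ->.
  by rewrite mulrC.
split=> //; first by apply/MU.
move=> v tv; have df0 : 'd f x v = 0.
  apply: tangent_diff0 tv dfz _.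
  have nU : nbhs x U by exact: open_nbhs_nbhs.
  by apply: filterS nU => y Uy My; apply/MU.
apply: (mulfI (fj x Uz)); rewrite /= mulr0 /dot mulr_sumr.
transitivity (xi 0 j * 'd f x v); last by rewrite df0 mulr0.
rewrite -deriveE // (directional_gradient v) // mulr_sumr; apply: eq_bigr => k _.
by rewrite mulrA hz -mulrA [X in _ * X]mulrC.
Qed.

Lemma conormal_eqn_conormal M U f j (z : cotangent R n) : local_equation M U f j ->
  U z.1 -> conormal M z -> conormal_eqn f j z = 0.
Proof. by move=> leq Uz /(conormalE leq Uz)[]. Qed.

End LocalEquation.

Section ConormalEquation.
Context {R : realType} {n : nat}.
Variables (U : set 'rV[R]_n) (f : 'rV[R]_n -> R) (j : 'I_n).
Hypotheses (oU : open U) (sf : smooth U f).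

Lemma smooth_conormal_eqn :
  smooth (fst @^-1` U : set (cotangent R n)) (conormal_eqn f j).
Proof.
have oA : open (fst @^-1` U : set (cotangent R n)) by exact: open_fst.
have sfst (g : 'rV[R]_n -> R) : smooth U g ->
    smooth (fst @^-1` U) (fun z : cotangent R n => g z.1).
  by move=> sg; exact: smooth_fst sg.
have sxi i : smooth (fst @^-1` U) (fun z : cotangent R n => z.2 0 i).
  move=> k; apply: (@smooth_snd _ _ _ _ _ setT (fun y : 'rV[R]_n => y 0 i)) => //.
  by move=> k'; apply: Ck_coord; [exact: openT|exact: Ck_id openT].
move=> k; apply: Ck_row => // i.
have -> : (fun z => conormal_eqn f j z 0 i) =
    (fun z : cotangent R n => 'D_('e_j) f z.1) * (fun z : cotangent R n => z.2 0 i)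
    + cst (-1) * ((fun z : cotangent R n => z.2 0 j)
                  * (fun z : cotangent R n => 'D_('e_i) f z.1))
    + cst (i == j)%:R * (fun z : cotangent R n => f z.1).
  by apply/funext => z; rewrite mxE !fctE /= mulN1r.
apply: CkD => //; first apply: CkD => //.
- by apply: CkM => //; [exact: (sfst _ (smooth_derive _ sf))|exact: sxi].
- apply: CkM => //; first exact: Ck_cst.
  by apply: CkM => //; [exact: sxi|exact: (sfst _ (smooth_derive _ sf))].
- by apply: CkM => //; [exact: Ck_cst|exact: sfst].
Qed.

Lemma diff_conormal_eqn x (xi v eta : 'rV[R]_n) k : U x ->
  'd (conormal_eqn f j) (x, xi) (v, eta) 0 k =
  'D_('e_j) f x * eta 0 k + xi 0 k * 'D_v ('D_('e_j) f) x
  - (xi 0 j * 'D_v ('D_('e_k) f) x + 'D_('e_k) f x * eta 0 j)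
  + (k == j)%:R * 'D_v f x.
Proof.
move=> Ux; set z := (x, xi); set w := (v, eta).
have Az : (fst @^-1` U) z by [].
have dh : differentiable (conormal_eqn f j) z.
  exact: (smooth_differentiable smooth_conormal_eqn Az).
have Dfst (g : 'rV[R]_n -> R) : smooth U g ->
    is_derive z w (fun z : cotangent R n => g z.1) ('D_v g x).
  move=> sg; have dg := smooth_differentiable sg Ux; have [d1 d2] := diff_fst xi dg.
  by apply: DeriveDef; [exact: diff_derivable|rewrite deriveE // d2 deriveE].
have Dxi i : is_derive z w (fun z : cotangent R n => z.2 0 i) (eta 0 i).
  have dg : differentiable (fun y : 'rV[R]_n => y 0 i) xi.
    exact: differentiable_coord.
  have [d1 d2] := diff_snd x dg.
  apply: DeriveDef; [exact: diff_derivable|rewrite deriveE // d2 -deriveE //].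
  by rewrite derive_coord // derive_id.
rewrite -deriveE // -derive_coord //.
have -> : (fun z => conormal_eqn f j z 0 k) =
    (fun z : cotangent R n => 'D_('e_j) f z.1) * (fun z : cotangent R n => z.2 0 k)
    - ((fun z : cotangent R n => z.2 0 j) * (fun z : cotangent R n => 'D_('e_k) f z.1))
    + (k == j)%:R *: (fun z : cotangent R n => f z.1).
  by apply/funext => y; rewrite mxE !fctE.
have H := is_deriveD (is_deriveB (is_deriveM (Dfst _ (smooth_derive 'e_j sf)) (Dxi k))
  (is_deriveM (Dxi j) (Dfst _ (smooth_derive 'e_k sf)))) (is_deriveZ (k == j)%:R (Dfst _ sf)).
by case: H => _ ->.
Qed.

Hypothesis fj : forall x, U x -> 'D_('e_j) f x != 0.

(** The component j is corrected by moving the base point along e_j, where f has a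
    nonzero derivative; each other component k is then corrected by xi_k, whose
    coefficient is 'D_j f. *)
Lemma conormal_eqn_submersion x xi : U x ->
  forall u, exists w, 'd (conormal_eqn f j) (x, xi) w = u.
Proof.
move=> Ux u; have Dj := fj Ux; have dfx := smooth_differentiable sf Ux.
(* Solves the j-th equation, 'D_v f x = u_j, in the direction e_j. *)
pose v : 'rV[R]_n := (u 0 j / 'D_('e_j) f x) *: 'e_j.
(* Solves the k-th equation given v, with eta_j = 0; at k = j the formula
   does evaluate to 0. *)
pose eta : 'rV[R]_n := \row_k
  ((u 0 k - (k == j)%:R * u 0 j - xi 0 k * 'D_v ('D_('e_j) f) x
    + xi 0 j * 'D_v ('D_('e_k) f) x) / 'D_('e_j) f x).
exists (v, eta); apply/rowP => k; rewrite diff_conormal_eqn //.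
have -> : 'D_v f x = u 0 j.
  by rewrite deriveE // linearZ /= -deriveE // [LHS](divfK Dj).
have -> : eta 0 j = 0.
  by rewrite mxE eqxx mul1r subrr sub0r addNr mul0r.
have solved (a d t s b c : R) : a != 0 ->
    a * ((t - d * s - b + c) / a) + b - c + d * s = t.
  by move=> a0; field.
by rewrite mxE mulr0 addr0; exact: solved.
Qed.

(** The conormal bundle is isotropic. On the kernel of the differential of the
    equations, the pairing of the fibre part eta of one vector with the base part w
    of another one is a multiple of the Hessian of f at (v, w); the canonical form
    is the antisymmetrization of this pairing, and the Hessian is symmetric. *)
Lemma conormal_isotropic x xi v eta w zeta : U x ->
  conormal_eqn f j (x, xi) = 0 ->
  'd (conormal_eqn f j) (x, xi) (v, eta) = 0 ->
  'd (conormal_eqn f j) (x, xi) (w, zeta) = 0 ->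
  omega (v, eta) (w, zeta) = 0.
Proof.
move=> Ux /conormal_eqn_eq0[/= fx hx] dv dw.
have Dj := fj Ux; have dfx := smooth_differentiable sf Ux.
(* The j-th linearized equation is 'D_a f x = 0. *)
have kerf (a b : 'rV[R]_n) : 'd (conormal_eqn f j) (x, xi) (a, b) = 0 -> 'D_a f x = 0.
  move=> /(congr1 (fun u : 'rV[R]_n => u 0 j)).
  rewrite diff_conormal_eqn // mxE eqxx mul1r.
  have cancel (s t u : R) : s + t - (t + s) + u = 0 -> u = 0 by move=> h; lra.
  exact: cancel.
(* The equations determine b up to a multiple of the gradient, which c kills. *)
have key (a b c : 'rV[R]_n) : 'd (conormal_eqn f j) (x, xi) (a, b) = 0 -> 'D_c f x = 0 ->
    'D_('e_j) f x * dot b c = xi 0 j * 'D_c ('D_a f) x.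
  move=> dab Dc; have Da := kerf _ _ dab.
  have Df2 : differentiable ('D_a f) x by exact: smooth_differentiable (smooth_derive a sf) Ux.
  have E k : 'D_('e_j) f x * b 0 k = xi 0 j * 'D_('e_k) ('D_a f) x
      + 'D_('e_k) f x * b 0 j - xi 0 k * 'D_('e_j) ('D_a f) x.
    have := congr1 (fun u : 'rV[R]_n => u 0 k) dab.
    rewrite diff_conormal_eqn // mxE Da mulr0 addr0.
    have swap d : 'D_a ('D_d f) x = 'D_d ('D_a f) x.
      exact: derive_swap oU (sf 2) Ux.
    rewrite (swap 'e_j) (swap 'e_k).
    have solved (s y r t : R) : s + y - (r + t) = 0 -> s = r + t - y.
      by move=> h; lra.
    exact: solved.
  have dotxi : 'D_('e_j) f x * dot xi c = 0.
    transitivity (xi 0 j * 'D_c f x); last by rewrite Dc mulr0.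
    rewrite (directional_gradient c) // /dot !mulr_sumr; apply: eq_bigr => k _.
    by rewrite mulrA hx -mulrA [X in _ * X]mulrC.
  have {}dotxi : dot xi c = 0.
    by apply: (mulfI Dj); rewrite mulr0.
  rewrite (directional_gradient c) //.
  transitivity (xi 0 j * (\sum_i c 0 i * 'D_('e_i) ('D_a f) x) + b 0 j * 'D_c f x
     - dot xi c * 'D_('e_j) ('D_a f) x); last first.
    by rewrite Dc dotxi mulr0 mul0r subr0 addr0.
  rewrite (directional_gradient c) // /dot !mulr_sumr mulr_suml -big_split /= -sumrB.
  apply: eq_bigr => k _.
  have distr (a0 b0 s t b1 y c0 z d : R) : a0 * b0 = s * t + y * b1 - c0 * z ->
      a0 * (b0 * d) = s * (d * t) + b1 * (d * y) - c0 * d * z.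
    by rewrite mulrA => ->; ring.
  exact: distr (E k).
apply: (mulfI Dj); rewrite mulr0 /omega /= mulrBr.
rewrite (key _ _ _ dv (kerf _ _ dw)) (key _ _ _ dw (kerf _ _ dv)).
by rewrite (derive_swap _ _ oU (sf 2) Ux) subrr.
Qed.

End ConormalEquation.

(** * The fibre diagonal and the center map *)

Section CenterMap.
Context {R : realType} {n : nat}.
Local Notation cotangent2 := (cotangent R n * cotangent R n)%type.

Definition fibre_difference (q : cotangent2) : 'rV[R]_n := q.1.2 - q.2.2.

Lemma fibre_difference_linear : linear (fibre_difference : cotangent2 -> 'rV[R]_n).
Proof. by move=> a u v; rewrite /fibre_difference /= scalerBr opprD addrACA. Qed.

HB.instance Definition _ := GRing.isLinear.Build R cotangent2 'rV[R]_n _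
  fibre_difference fibre_difference_linear.

Lemma fibre_difference_continuous : continuous fibre_difference.
Proof.
move=> q.
have c1 : {for q, continuous (@fst (cotangent R n) (cotangent R n))} by exact: fst_cont.
have c2 : {for q, continuous (@snd (cotangent R n) (cotangent R n))} by exact: snd_cont.
have c12 := continuous_comp c1 (@snd_cont _ 'rV[R]_n 'rV[R]_n q.1).
have c22 := continuous_comp c2 (@snd_cont _ 'rV[R]_n 'rV[R]_n q.2).
exact: continuousB c12 c22.
Qed.

Lemma center_map_linear : linear (@center_map R n : cotangent2 -> cotangent R n).
Proof.
move=> a u v; apply: injective_projections => /=.
  rewrite addrACA [in RHS]scalerA [in RHS]mulrC -[in RHS]scalerA -[RHS]scalerDr.
  by congr (_ *: _); rewrite scalerDr.
by rewrite [in RHS]scalerA [in RHS]mulrC -[in RHS]scalerA -[RHS]scalerDr.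
Qed.

HB.instance Definition _ := GRing.isLinear.Build R cotangent2 (cotangent R n) _
  (@center_map R n) center_map_linear.

Lemma center_map_continuous : continuous (@center_map R n).
Proof.
move=> q.
have c1 : {for q, continuous (@fst (cotangent R n) (cotangent R n))} by exact: fst_cont.
have c2 : {for q, continuous (@snd (cotangent R n) (cotangent R n))} by exact: snd_cont.
have c11 := continuous_comp c1 (@fst_cont _ 'rV[R]_n 'rV[R]_n q.1).
have c21 := continuous_comp c2 (@fst_cont _ 'rV[R]_n 'rV[R]_n q.2).
have c12 := continuous_comp c1 (@snd_cont _ 'rV[R]_n 'rV[R]_n q.1).
have cA := continuousD c11 c21.
have cB := continuous_comp cA (@scaler_continuous _ _ (2^-1 : R) _).
have cC := continuous_comp c12 (@scaler_continuous _ _ (2 : R) _).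
exact: (cvg_pair cB cC).
Qed.

Lemma diff_center_map (p v : cotangent2) : 'd (@center_map R n) p v = center_map v.
Proof.
exact: (congr1 (fun g : cotangent2 -> cotangent R n => g v)
  (diff_lin p center_map_continuous)).
Qed.

End CenterMap.

(** * The center lift *)

Section CenterLift.
Context {R : realType} {n : nat}.
Local Notation cotangent2 := (cotangent R n * cotangent R n)%type.
Implicit Types (M U : set 'rV[R]_n) (f : 'rV[R]_n -> R) (j : 'I_n).

Lemma dim_double_cotangent : dim cotangent2 = (n + (n + (n + n)))%N.
Proof.
have -> : dim cotangent2
    = (dim 'rV[R]_n + dim 'rV[R]_n + (dim 'rV[R]_n + dim 'rV[R]_n))%N by [].
by rewrite dim_matrix mul1r -addnA.
Qed.

Lemma tangent_fibre_diagonal (S : set cotangent2) p v :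
  (forall q, S q -> fibre_diagonal q) -> tangent_space S p v -> v.1.2 = v.2.2.
Proof.
move=> SD tv; apply/eqP; rewrite -subr_eq0; apply/eqP.
have cL := @fibre_difference_continuous R n.
rewrite -[LHS]/(fibre_difference v) -(diff_lin p cL).
apply: (tangent_diff0 tv); first exact: linear_differentiable.
by near=> q; move=> /SD[_ /= qD]; rewrite /fibre_difference qD subrr.
Unshelve. all: by end_near. Qed.

(** The conormal equations, read on the first factor, vanish on S near the point. *)
Lemma tangent_conormal_fst M U f j (S : set cotangent2)
    (z1 z2 : cotangent R n) (v : cotangent2) :
  local_equation M U f j -> U z1.1 -> (forall q, S q -> conormal M q.1) ->
  tangent_space S (z1, z2) v -> 'd (conormal_eqn f j) z1 v.1 = 0.
Proof.
move=> leq Uz SM tv; have [oU sf _ _] := leq.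
have Az : (fst @^-1` U) z1 by [].
have dh := smooth_differentiable (smooth_conormal_eqn j oU sf) Az.
have [d1 <-] := diff_fst z2 dh.
apply: tangent_diff0 tv d1 _.
have oA : open (fst @^-1` (fst @^-1` U) : set cotangent2) by do 2 apply: open_fst.
have nA : nbhs (z1, z2) (fst @^-1` (fst @^-1` U) : set cotangent2) by apply: open_nbhs_nbhs.
by apply: filterS nA => q Uq Sq; apply: conormal_eqn_conormal leq Uq (SM q Sq).
Qed.

Lemma tangent_conormal_snd M U f j (S : set cotangent2)
    (z1 z2 : cotangent R n) (v : cotangent2) :
  local_equation M U f j -> U z2.1 -> (forall q, S q -> conormal M q.2) ->
  tangent_space S (z1, z2) v -> 'd (conormal_eqn f j) z2 v.2 = 0.
Proof.
move=> leq Uz SM tv; have [oU sf _ _] := leq.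
have Az : (fst @^-1` U) z2 by [].
have dh := smooth_differentiable (smooth_conormal_eqn j oU sf) Az.
have [d1 <-] := diff_snd z1 dh.
apply: tangent_diff0 tv d1 _.
have oA : open (snd @^-1` (fst @^-1` U) : set cotangent2).
  by apply: open_snd; apply: open_fst.
have nA : nbhs (z1, z2) (snd @^-1` (fst @^-1` U) : set cotangent2) by apply: open_nbhs_nbhs.
by apply: filterS nA => q Uq Sq; apply: conormal_eqn_conormal leq Uq (SM q Sq).
Qed.

Variables (M1 M2 : set 'rV[R]_n).
Hypotheses (hM1 : hypersurface M1) (hM2 : hypersurface M2).

Lemma center_lift_conic : conic (center_lift M1 M2).
Proof.
have sc M x (xi : 'rV[R]_n) (t : R) : 0 < t -> conormal M (x, xi) -> conormal M (x, t *: xi).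
  move=> t0 [Mx xi0 txi]; split=> //=; first by rewrite scaler_eq0 negb_or gt_eqF.
  by move=> v /txi /= xv; rewrite dotC dotZr dotC xv mulr0.
move=> _ t [x1 [x2 [xi [h1 h2 ->]]]] t0.
exists x1, x2, (t *: xi); split; [exact: sc|exact: sc|].
by rewrite /= !scalerA mulrC.
Qed.

Lemma conormal_tangent_isotropic (p : cotangent2) v w : (conormal M1 `*` conormal M2) p ->
  tangent_space (conormal M1 `*` conormal M2) p v ->
  tangent_space (conormal M1 `*` conormal M2) p w ->
  omega v.1 w.1 = 0 /\ omega v.2 w.2 = 0.
Proof.
case: p v w => [[x1 xi1] [x2 xi2]] [[a1 al1] [a2 al2]] [[b1 be1] [b2 be2]] [/= N1 N2] tv tw.
have [U1 [f1 [j1 [leq1 Ux1]]]] := hypersurface_local_equation hM1 (let: And3 H _ _ := N1 in H).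
have [U2 [f2 [j2 [leq2 Ux2]]]] := hypersurface_local_equation hM2 (let: And3 H _ _ := N2 in H).
have [oU1 sf1 _ fj1] := leq1; have [oU2 sf2 _ fj2] := leq2.
have fS q : (conormal M1 `*` conormal M2) q -> conormal M1 q.1 by case.
have sS q : (conormal M1 `*` conormal M2) q -> conormal M2 q.2 by case.
split.
  apply: (conormal_isotropic oU1 sf1 fj1 Ux1 (conormal_eqn_conormal leq1 Ux1 N1)).
    exact: tangent_conormal_fst leq1 Ux1 fS tv.
  exact: tangent_conormal_fst leq1 Ux1 fS tw.
apply: (conormal_isotropic oU2 sf2 fj2 Ux2 (conormal_eqn_conormal leq2 Ux2 N2)).
  exact: tangent_conormal_snd leq2 Ux2 sS tv.
exact: tangent_conormal_snd leq2 Ux2 sS tw.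
Qed.

Hypothesis htr :
  transverse (conormal M1 `*` conormal M2) (@fibre_diagonal R n).

(** The fibre product is cut out by the two conormal equations and the equality of
    the fibre components, 3n equations in dimension 4n. The conormal equations and
    the fibre equation are submersions separately, and transversality makes them
    independent. *)
Lemma center_domain_submanifold : submanifold n (center_domain M1 M2).
Proof.
case=> [[x1 xi1] [x2 xi2]] [[/= N1 N2] [[/= n1 n2] /= e12]].
have [U1 [f1 [j1 [leq1 Ux1]]]] := hypersurface_local_equation hM1 (let: And3 H _ _ := N1 in H).
have [U2 [f2 [j2 [leq2 Ux2]]]] := hypersurface_local_equation hM2 (let: And3 H _ _ := N2 in H).
have [oU1 sf1 _ fj1] := leq1; have [oU2 sf2 _ fj2] := leq2.
pose B U : set (cotangent R n) := (fst @^-1` U) `&` (snd @^-1` [set xi | xi != 0]).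
have oB U : open U -> open (B U).
  move=> oU; apply: openI; first exact: open_fst.
  apply: open_snd.
  have -> : [set xi : 'rV[R]_n | xi != 0] = setT `&` [set xi | `|xi| != 0].
    by apply/funext => y /=; apply/propext; rewrite /= normr_eq0; split=> [|[]].
  by apply: open_neq0; [exact: openT|move=> y _; exact: norm_continuous].
pose A : set cotangent2 := (fst @^-1` (B U1)) `&` (snd @^-1` (B U2)).
have oA : open A.
  by apply: openI; [apply: open_fst; exact: oB|apply: open_snd; exact: oB].
pose h1 := conormal_eqn f1 j1; pose h2 := conormal_eqn f2 j2.
have s1 : smooth A (fun q : cotangent2 => h1 q.1).
  apply: (smooth_fst oA _ (smooth_conormal_eqn j1 oU1 sf1)).
  by move=> q [[Uq _] _].
have s2 : smooth A (fun q : cotangent2 => h2 q.2).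
  apply: (smooth_snd oA _ (smooth_conormal_eqn j2 oU2 sf2)).
  by move=> q [_ [Uq _]].
have s3 : smooth A (@fibre_difference R n).
  by apply: smooth_linear => //; exact: fibre_difference_continuous.
pose H23 (q : cotangent2) := row_mx (h2 q.2) (fibre_difference q).
pose H (q : cotangent2) := row_mx (h1 q.1) (H23 q).
have s23 : smooth A H23 by exact: smooth_row_mx.
have sH : smooth A H by exact: smooth_row_mx.
exists (n + (n + n))%N, A, H; split=> //.
  apply/seteqP; split=> -[[y1 eta1] [y2 eta2]].
    move=> [[[/= C1 C2] [_ /= eq12]] Aq]; split=> //=.
    have [[/= u1 _] [/= u2 _]] := Aq.
    rewrite /H /H23 /= /h1 /h2 (conormal_eqn_conormal leq1 _ C1) //
      (conormal_eqn_conormal leq2 _ C2) //.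
    by rewrite /fibre_difference /= eq12 subrr !row_mx0.
  move=> [/= H0 Aq]; split=> //.
  have [[/= u1 m1] [/= u2 m2]] := Aq.
  move: H0; rewrite /H /H23 -[X in _ = X]row_mx0 => /eq_row_mx[e1].
  rewrite -[X in _ = X]row_mx0 => /eq_row_mx[e2 e3].
  split; first by split; [apply/(conormalE leq1)|apply/(conormalE leq2)].
  split; first by split.
  by move/eqP: e3; rewrite /fibre_difference /= subr_eq0 => /eqP.
case=> [[y1 eta1] [y2 eta2]] [[[/= C1 C2] FD] Aq].
have [[/= u1 _] [/= u2 _]] := Aq.
set q : cotangent2 := (_, _).
have dH : differentiable H q by exact: smooth_differentiable sH Aq.
have d23 : differentiable H23 q by exact: smooth_differentiable s23 Aq.
have d1 := smooth_differentiable s1 Aq; have d2 := smooth_differentiable s2 Aq.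
have d3 := smooth_differentiable s3 Aq.
have A1 : (fst @^-1` U1) (y1, eta1) by [].
have A2 : (fst @^-1` U2) (y2, eta2) by [].
have [_ E1] := diff_fst (y2, eta2) (smooth_differentiable (smooth_conormal_eqn j1 oU1 sf1) A1).
have [_ E2] := diff_snd (y1, eta1) (smooth_differentiable (smooth_conormal_eqn j2 oU2 sf2) A2).
have cL := @fibre_difference_continuous R n.
have dHE (w : cotangent2) : 'd H q w = row_mx ('d h1 (y1, eta1) w.1)
    (row_mx ('d h2 (y2, eta2) w.2) (w.1.2 - w.2.2)).
  have D1 := @diff_row_mx R cotangent2 n (n + n) (fun q => h1 q.1) H23 q w dH d1 d23.
  have D2 := @diff_row_mx R cotangent2 n n (fun q => h2 q.2)
    (@fibre_difference R n) q w d23 d2 d3.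
  have D3 : 'd (@fibre_difference R n) q w = w.1.2 - w.2.2.
    exact: (congr1 (fun g : cotangent2 -> 'rV[R]_n => g w) (diff_lin q cL)).
  have E1w := E1 w.
  have E2w := E2 w.
  have D2' : 'd H23 q w = row_mx ('d h2 (y2, eta2) w.2) (w.1.2 - w.2.2).
    refine (etrans D2 _).
    exact (f_equal2 (@row_mx R 1 n n) E2w D3).
  refine (etrans D1 _).
  exact (f_equal2 (@row_mx R 1 n (n + n)) E1w D2').
(* Reach the conormal targets by a and the fibre target by b; transversality
   splits b - a into v, invisible to the conormal equations, and w, invisible to
   the fibre equation, so that a + v = b - w has both right values. *)
have surj u : exists v, 'd H q v = u.
  have [a1 Ea1] := conormal_eqn_submersion oU1 sf1 fj1 eta1 u1 (lsubmx u).
  have [a2 Ea2] := conormal_eqn_submersion oU2 sf2 fj2 eta2 u2 (lsubmx (rsubmx u)).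
  pose a : cotangent2 := (a1, a2); pose b : cotangent2 := ((0, rsubmx (rsubmx u)), 0).
  have NN : (conormal M1 `*` conormal M2) q by split.
  have [v [w [tv tw ab]]] := htr NN FD (b - a).
  have tv1 : 'd h1 (y1, eta1) v.1 = 0.
    by apply: (tangent_conormal_fst leq1 _ _ tv) => // r [].
  have tv2 : 'd h2 (y2, eta2) v.2 = 0.
    by apply: (tangent_conormal_snd leq2 _ _ tv) => // r [].
  have tw3 : w.1.2 = w.2.2 by apply: (tangent_fibre_diagonal _ tw).
  have av : a + v = b - w.
    by apply/eqP; rewrite eq_sym subr_eq -addrA -ab addrCA subrr addr0.
  have -> : u = row_mx (lsubmx u)
      (row_mx (lsubmx (rsubmx u)) (rsubmx (rsubmx u))) by rewrite !hsubmxK.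
  exists (a + v); rewrite dHE.
  congr row_mx; last congr row_mx.
  - by rewrite linearD /= [X in _ + X]tv1 addr0.
  - by rewrite linearD /= [X in _ + X]tv2 addr0.
  - by rewrite av /= tw3 sub0r opprK subrK.
split=> //.
exact: (@kernel_basis R cotangent2 (n + (n + n)) n ('d H q) dim_double_cotangent surj).
Qed.

End CenterLift.

Theorem theorem2p10 (R : realType) (n : nat) (M1 M2 : set 'rV[R]_n)
    (hM1 : hypersurface M1) (hM2 : hypersurface M2)
    (htr : transverse (conormal M1 `*` conormal M2) (@fibre_diagonal R n)) :
  conic (center_lift M1 M2) /\
  immersed_lagrangian (center_domain M1 M2) (@center_map R n)
    (center_lift M1 M2).
Proof.
split; first exact: center_lift_conic.
have PN : center_domain M1 M2 `<=` conormal M1 `*` conormal M2 by move=> q [].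
have iso (p v w : cotangent R n * cotangent R n) :
    center_domain M1 M2 p -> tangent_space (center_domain M1 M2) p v ->
    tangent_space (conormal M1 `*` conormal M2) p w ->
    omega v.1 w.1 = 0 /\ omega v.2 w.2 = 0.
  move=> Pp tv tw; apply: (conormal_tangent_isotropic hM1 hM2 (PN _ Pp)) => //.
  exact: tangent_spaceS PN _ tv.
have tD (p v : cotangent R n * cotangent R n) :
    tangent_space (center_domain M1 M2) p v -> v.1.2 = v.2.2.
  by apply: tangent_fibre_diagonal => q [].
split.
- exact: center_domain_submanifold.
- exists setT; split=> //; first exact: openT.
  by apply: smooth_linear; [exact: openT|exact: center_map_continuous].
- move=> p v Pp tv; rewrite diff_center_map => Fv0.
  have vD := tD _ _ tv.
  have Fv1 := congr1 fst Fv0; have Fv2 := congr1 snd Fv0.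
  case: v vD tv Fv1 Fv2 {Fv0} => [[a1 al1] [a2 al2]] /= <- tv /eqP Fv1 /eqP Fv2.
  have {Fv1} a12 : a2 = - a1.
    move: Fv1; rewrite scaler_eq0 invr_eq0 pnatr_eq0 /= addrC addr_eq0.
    by move=> /eqP.
  have {Fv2} al0 : al1 = 0 by move: Fv2; rewrite scaler_eq0 pnatr_eq0 /= => /eqP.
  have [N12 FD] := Pp.
  (* The vector is now ((a1, 0), (- a1, 0)). Isotropy on each
     factor says that a1 pairs to zero with the fibre parts be1 and be2 of a vector
     tangent to the conormal bundles, and by transversality c is a difference
     be1 - be2 of such parts. *)
  suff a0 : a1 = 0 by rewrite a12 al0 a0 oppr0.
  apply: dot_eq0 => c.
  have [w [x [tw tx]]] := htr p N12 FD ((0, c), (0, 0)).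
  have xD : x.1.2 = x.2.2 by apply: (tangent_fibre_diagonal _ tx).
  have [] := iso p _ w Pp tv tw.
  case: w x tw tx xD => [[b1 be1] [b2 be2]] [[c1 g1] [c2 g2]] tw tx /= <-.
  rewrite /omega /= a12 al0 !dot0l !sub0r => /eqP i1 /eqP i2 [_ E1 _ E2].
  have -> : c = be1 - be2.
    by rewrite E1 -[LHS]subr0 E2 opprD addrACA subrr addr0.
  move: i2; rewrite dotNr opprK => /eqP i2.
  by move: i1; rewrite oppr_eq0 dotBl i2 subr0 => /eqP.
- move=> p v w Pp tv tw; rewrite (diff_center_map p v) (diff_center_map p w).
  have [i1 i2] := iso p v w Pp tv (tangent_spaceS PN tw).
  have vD := tD _ _ tv; have wD := tD _ _ tw.
  rewrite /omega /center_map /= !dot_double_half !dotDr opprD addrACA.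
  by rewrite {2}vD {2}wD -/(omega v.1 w.1) -/(omega v.2 w.2) i1 i2 addr0.
- split.
    apply/seteqP; split=> [z [x1 [x2 [xi [h1 h2 ->]]]]
      |z [[[x1 xi1] [x2 xi2]] [[/= h1 h2] [_ /= e]] <-]].
      exists ((x1, xi), (x2, xi)) => //; split=> //; split=> //=.
      by case: h1 => _ /= + _; case: h2 => _ /= + _.
    by exists x1, x2, xi1; split=> //; rewrite e.
  move=> z [x1 [x2 [xi [[_ /= xi0 _] _ ->]]]].
  by rewrite /zero_section_compl /= scaler_eq0 pnatr_eq0.
Qed.
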